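(* Let $G$ be a finite plane graph and $\mathcal{H}$ a collection of connected vertex sets of $G$ that spans $G$, such that each member of $\mathcal{H}$ contains a vertex incident to the outer face of $G$. Then there is a $(770,9)$-impression $(G,\mathcal{M})$ of $(G,\mathcal{H})$ such that each set in $\mathcal{M}$ contains a vertex incident to the outer face of $G$.
   Context: A plane graph is a planar graph with a fixed embedding in $\mathbb{R}^2$; its outer face is the unbounded face. A vertex set $A$ is connected if $G[A]$ is connected. $\mathcal{H}$ spans $G$ if for every edge $uv$ of $G$ some $H\in\mathcal{H}$ contains both $u$ and $v$. The weak diameter of a vertex set $A$ in a graph $X$ is $\max_{a,b\in A}d_X(a,b)$ (shortest-path distance). $I_{\mathcal{C}}(F)$ denotes the members of a collection $\mathcal{C}$ that intersect $F$. $\mathbf{RIG}(G,\mathcal{H})$ is the graph on $\mathcal{H}$ with distinct members adjacent iff they intersect. Disjoint vertex sets touch if an edge of $G$ joins them; for a collection $\mathcal{M}$ of pairwise disjoint connected vertex sets, $\mathbf{IM}(G,\mathcal{M})$ is the graph on $\mathcal{M}$ with distinct members adjacent iff they touch. $(G,\mathcal{M})$, with $\mathcal{M}$ a collection of pairwise disjoint connected vertex sets, is an $(x,y)$-impression of $(G,\mathcal{H})$ if (i) for every $M\in\mathcal{M}$, $I_{\mathcal{H}}(M)$ has weak diameter at most $x$ in $\mathbf{RIG}(G,\mathcal{H})$; (ii) for every $H\in\mathcal{H}$, $I_{\mathcal{M}}(H)$ has weak diameter at most $y$ in $\mathbf{IM}(G,\mathcal{M})$; (iii) $\bigcup_{M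\in\mathcal{M}}M=V(G)$.
   Formalization: It is additionally assumed that every isolated vertex of G is incident to the outer face; without this the claim fails (a triangle with an isolated vertex inside and H consisting of the triangle), and the condition is necessary for the conclusion. *)

(* Defs.v *)
From mathcomp Require Import all_boot all_order all_algebra.

Set Implicit Arguments.
Unset Strict Implicit.
Unset Printing Implicit Defensive.

Record sgraph := SGraph {
  vertex :> finType;
  adj : rel vertex;
  adj_sym : symmetric adj;
  adj_irr : irreflexive adj
}.

Section Graphs.
Variable G : sgraph.
Implicit Types (A B F M : {set G}) (C H : {set {set G}}).

Definition induced_adj A : rel G :=
  [rel x y | [&& x \in A, y \in A & adj x y]].

Definition connected_vset A : Prop :=
  A != set0 /\ {in A &, forall x y, connect (induced_adj A) x y}.

(* d_G(x, y) <= k; false for every k when x and y lie in different components *)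
Definition dist_le (x y : G) (k : nat) : Prop :=
  exists p : seq G, [/\ path (@adj G) x p, last x p = y & size p <= k].

Definition weak_diameter_le A (k : nat) : Prop :=
  {in A &, forall x y, dist_le x y k}.

Definition spans H : Prop :=
  forall u v : G, adj u v -> exists2 A, A \in H & (u \in A) && (v \in A).

Definition touch A B : bool := [exists x in A, exists y in B, adj x y].

Definition intersects A B : bool := A :&: B != set0.

Definition members C : finType := {A : {set G} | A \in C}.

Definition rig_adj C : rel (members C) :=
  [rel A B | (A != B) && intersects (val A) (val B)].

Definition im_adj C : rel (members C) :=
  [rel A B | (A != B) && touch (val A) (val B)].

Lemma rig_adj_sym C : symmetric (@rig_adj C).
Proof. by move=> A B; rewrite /rig_adj /= eq_sym /intersects setIC. Qed.

Lemma rig_adj_irr C : irreflexive (@rig_adj C).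
Proof. by move=> A; rewrite /rig_adj /im_adj /= eqxx. Qed.

Lemma im_adj_sym C : symmetric (@im_adj C).
Proof.
move=> A B; rewrite /im_adj /= eq_sym; congr (_ && _).
by apply/exists_inP/exists_inP => -[x xA /exists_inP[y yB xy]];
  exists y => //; apply/exists_inP; exists x => //; rewrite adj_sym.
Qed.

Lemma im_adj_irr C : irreflexive (@im_adj C).
Proof. by move=> A; rewrite /rig_adj /im_adj /= eqxx. Qed.

End Graphs.

Definition RIG (G : sgraph) (H : {set {set G}}) : sgraph :=
  SGraph (@rig_adj_sym G H) (@rig_adj_irr G H).

Definition IM (G : sgraph) (M : {set {set G}}) : sgraph :=
  SGraph (@im_adj_sym G M) (@im_adj_irr G M).

(* I_C(F), as a set of elements of the subtype of members of C, which is the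
   vertex type of both RIG G C and IM G C *)
Definition meeting (G : sgraph) (C : {set {set G}}) (F : {set G}) :
  {set members C} := [set A : members C | intersects (val A) F].

Definition impression (G : sgraph) (H M : {set {set G}}) (x y : nat) : Prop :=
  [/\ trivIset M /\ (forall A, A \in M -> connected_vset A),
      forall A, A \in M -> @weak_diameter_le (RIG H) (meeting H A) x,
      forall A, A \in H -> @weak_diameter_le (IM M) (meeting M A) y
    & cover M = setT].

From mathcomp Require Import all_classical all_reals all_analysis.
Import numFieldNormedType.Exports.
Local Open Scope classical_set_scope.
Local Open Scope ring_scope.

Notation plane R := (R * R)%type (only parsing).

Definition is_arc (R : realType) (x y : plane R) (A : set (plane R)) : Prop :=
  exists g : R -> plane R,
    [/\ {within `[0, 1], continuous g},
        {in `[0, 1] &, injective g},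
        g 0 = x, g 1 = y & g @` `[0, 1] = A].

(* A drawing of G: vertices are distinct points, edges are Jordan arcs between
   their ends, and the interior of an edge contains no vertex and no point of
   another edge.  The value of edge u v is irrelevant when u, v are not
   adjacent. *)
Record plane_embedding (R : realType) (G : sgraph) := PlaneEmbedding {
  pos : G -> plane R;
  edge : G -> G -> set (plane R);
  pos_inj : injective pos;
  edge_sym : forall u v, edge u v = edge v u;
  edge_arc : forall u v, adj u v -> is_arc (pos u) (pos v) (edge u v);
  edge_vertex : forall u v w, adj u v -> edge u v (pos w) -> w = u \/ w = v;
  edge_edge : forall u v x y, adj u v -> adj x y ->
    [set u; v]%SET <> [set x; y]%SET ->
    (edge u v `\` [set pos u; pos v]) `&` edge x y = set0
}.

Section Faces.
Variables (R : realType) (G : sgraph) (E : plane_embedding R G).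

Definition drawing : set (plane R) :=
  [set p | (exists v, p = pos E v) \/ exists u v, adj u v /\ edge E u v p].

Definition is_face (F : set (plane R)) : Prop :=
  exists2 p, (~` drawing) p & F = connected_component (~` drawing) p.

Definition is_outer_face (F : set (plane R)) : Prop :=
  is_face F /\ ~ bounded_set F.

(* v lies on the frontier of the outer face; closure and frontier agree at
   pos v, since pos v is not a point of any face *)
Definition outer_vertex (v : G) : Prop :=
  exists2 F, is_outer_face F & closure F (pos E v).

End Faces.

(* Main.v *)
(* Let [level A] be the distance in RIG(G, H) from [A] to a fixed root of its
   component.  Cut G into layers of thickness 4 by the balls around the roots,
   where the pieces of the complement of a ball that do not reach the outer face
   are added to the ball, and let M consist of the components of the layers.

   Planarity is used only to exclude the following: three vertices joined to two
   further vertices and to the outer face by nine connected sets, of which only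
   those belonging to independent edges of K_{3,3} have to be disjoint.  A layer
   component Q touches the previous layer in members of H whose towers lead down
   to the root; three of them pairwise at distance at least 3 would give such a
   K_{3,3} with Q and the root, so they form two clusters of bounded diameter,
   and Q, being connected, has bounded diameter itself.  In the same way a member
   of H meets at most two components of the lower of the at most two layers that
   it meets.

   K_{3,3} is excluded by van Kampen's argument: along two disjoint curves e, f
   the direction of f(t) - e(s) varies continuously, which relates the winding of
   f about the ends of e to that of e about the ends of f.  Summing over all
   independent pairs of edges gives a contradiction modulo 2.  Fine chains of
   points replace curves, and quadrants replace angles. *)

Require Import Defs.
From mathcomp Require Import all_boot.
From mathcomp Require boolp.
From mathcomp Require Import zify.

Set Implicit Arguments.
Unset Strict Implicit.
Unset Printing Implicit Defensive.

(** * Graph distances and connected vertex sets *)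

Section Distance.
Variable X : sgraph.
Implicit Types x y z : X.

Lemma dist_le_refl x n : dist_le x x n.
Proof. by exists [::]. Qed.

Lemma dist_le_mono x y m n : m <= n -> dist_le x y m -> dist_le x y n.
Proof. by move=> mn [p [xp yp pm]]; exists p; split=> //; apply: leq_trans mn. Qed.

Lemma dist_le_trans y x z m n :
  dist_le x y m -> dist_le y z n -> dist_le x z (m + n).
Proof.
move=> [p [xp yp pm]] [q [yq zq qn]]; exists (p ++ q).
by rewrite cat_path last_cat yp size_cat xp leq_add.
Qed.

Lemma dist_le_adj x y : adj x y -> dist_le x y 1.
Proof. by move=> xy; exists [:: y] => /=; rewrite xy. Qed.

Lemma dist_le_sym x y n : dist_le x y n -> dist_le y x n.
Proof.
move=> [p [xp yp pn]]; elim: p x n xp yp pn => [|z p IH] x n /=.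
  by move=> _ -> _; apply: dist_le_refl.
case/andP=> xz zp yp; case: n => // n pn.
rewrite -addn1; apply: dist_le_trans (IH _ _ zp yp pn) _.
by apply: dist_le_adj; rewrite adj_sym.
Qed.

End Distance.

Section Connectivity.
Variable G : sgraph.
Implicit Types (u v w x y : G) (S T Z A : {set G}).

Lemma induced_adj_sym S : symmetric (induced_adj S).
Proof. by move=> x y; rewrite /induced_adj /= adj_sym andbCA. Qed.

Lemma induced_connect_sym S x y :
  connect (induced_adj S) x y = connect (induced_adj S) y x.
Proof. exact/sym_connect_sym/induced_adj_sym. Qed.

Lemma induced_connectS S T x y : S \subset T ->
  connect (induced_adj S) x y -> connect (induced_adj T) x y.
Proof.
move=> /subsetP ST; apply: connect_sub => {x y} x y /and3P[xS yS xy].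
by apply: connect1; rewrite /induced_adj /= !ST.
Qed.

Lemma induced_connect_adj S x y :
  connect (induced_adj S) x y -> connect (@adj G) x y.
Proof. by apply: connect_sub => {x y} x y /and3P[_ _ xy]; apply: connect1. Qed.

Lemma induced_connect_mem S x y :
  connect (induced_adj S) x y -> x \in S -> y \in S.
Proof.
move=> /connectP[p xp ->]; elim: p x xp => //= z p IH x /andP[/and3P[_ zS _] zp] _.
exact: IH.
Qed.

(** Stop a walk from [u] to [w] inside [S] at its first vertex [y] of [Z]; the predecessor [x] is
    reached without entering [Z]. *)
Lemma first_hit S Z u w : connected_vset S -> u \in S -> u \notin Z ->
  w \in S -> w \in Z ->
  exists x y, [/\ connect (induced_adj (S :\: Z)) u x, x \in S :\: Z,
                  y \in S, y \in Z & adj x y].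
Proof.
move=> [_ cS] uS uZ wS wZ; have /connectP[p up wE] := cS _ _ uS wS.
elim: p u uS uZ up wE => [|z p IH] u uS uZ /=.
  by move=> _ wE; rewrite -wE wZ in uZ.
case/andP=> /and3P[_ zS uz] zp wE.
have [zZ|zZ] := boolP (z \in Z).
  by exists u, z; split=> //; rewrite inE uZ.
have [x [y [zx xS yS yZ xy]]] := IH _ zS zZ zp wE.
exists x, y; split=> //; apply: connect_trans zx; apply: connect1.
by rewrite /induced_adj /= !inE uZ uS zZ zS.
Qed.

Lemma connected_vsetU A B u v : connected_vset A -> connected_vset B ->
  u \in A -> v \in B -> (u == v) || adj u v -> connected_vset (A :|: B).
Proof.
move=> [_ cA] [_ cB] uA vB uv; split; first by apply/set0Pn; exists u; rewrite inE uA.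
have uvc : connect (induced_adj (A :|: B)) u v.
  case/orP: uv => [/eqP->//|uv]; apply: connect1.
  by rewrite /induced_adj /= !inE uA vB orbT.
have toA x : x \in A -> connect (induced_adj (A :|: B)) u x.
  by move=> xA; apply: (induced_connectS (subsetUl A B)); apply: cA.
have toB x : x \in B -> connect (induced_adj (A :|: B)) u x.
  move=> xB; apply: connect_trans uvc _.
  by apply: (induced_connectS (subsetUr A B)); apply: cB.
move=> x y xS yS; apply: (@connect_trans _ _ u).
  by rewrite induced_connect_sym; case/setUP: xS => [/toA|/toB].
by case/setUP: yS => [/toA|/toB].
Qed.

(** [D n u v] stands for a distance of at most [n], kept abstract so that it serves both for members
    of [H] and for parts. On a walk in [S] from a vertex near one centre to a vertex near the other,
    some edge changes cluster or some vertex lies in both, so the centres are within [2 * c + a];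
    reaching them costs [c] at either end. *)
Lemma two_clusters S (D : nat -> G -> G -> Prop) (a c : nat) (p q : G) :
  connected_vset S ->
  (forall n u v, D n u v -> D n v u) ->
  (forall m n u v w, D m u v -> D n v w -> D (m + n) u w) ->
  (forall m n u v, m <= n -> D m u v -> D n u v) ->
  (forall u v, u \in S -> v \in S -> adj u v -> D a u v) ->
  (forall v, v \in S -> D c v p \/ D c v q) ->
  forall u v, u \in S -> v \in S -> D (4 * c + a) u v.
Proof.
move=> [_ cS] Dsym Dtr Dle Dadj Dpq.
have mid u v p' q' : (forall v, v \in S -> D c v p' \/ D c v q') ->
    u \in S -> v \in S -> D c u p' -> D c v q' -> D (2 * c + a) p' q'.
  move=> cl uS vS; have /connectP[s us ->] := cS _ _ uS vS.
  elim: s u uS us => [|w s IH] u uS /=.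
    move=> _ up uq; apply: Dle (Dtr _ _ _ _ _ (Dsym _ _ _ up) uq); lia.
  case/andP=> /and3P[_ wS uw] ws up lq.
  have [wp|wq] := cl _ wS; first exact: IH ws wp lq.
  apply: Dle (Dtr _ _ _ _ _ (Dsym _ _ _ up) (Dtr _ _ _ _ _ (Dadj _ _ uS wS uw) wq)).
  lia.
move=> u v uS vS.
have cl' w : w \in S -> D c w q \/ D c w p by move=> /Dpq[]; [right|left].
have [up|uq] := Dpq _ uS; have [vp|vq] := Dpq _ vS.
- apply: Dle (Dtr _ _ _ _ _ up (Dsym _ _ _ vp)); lia.
- have m := mid _ _ _ _ Dpq uS vS up vq.
  apply: Dle (Dtr _ _ _ _ _ up (Dtr _ _ _ _ _ m (Dsym _ _ _ vq))); lia.
- have m := mid _ _ _ _ cl' uS vS uq vp.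
  apply: Dle (Dtr _ _ _ _ _ uq (Dtr _ _ _ _ _ m (Dsym _ _ _ vp))); lia.
- apply: Dle (Dtr _ _ _ _ _ uq (Dsym _ _ _ vq)); lia.
Qed.

End Connectivity.

(** * Distances in the intersection graph *)

Section RigDistance.
Variables (G : sgraph) (H : {set {set G}}).
Implicit Types A B C : {set G}.

(** Distance is read on plain vertex sets instead of elements of the subtype; membership of both
    sets in [H] is implied. *)
Definition rig_near n A B :=
  exists a b : RIG H, [/\ val a = A, val b = B & dist_le a b n].

Lemma rig_near_refl n A : A \in H -> rig_near n A A.
Proof. by move=> AH; exists (Sub A AH), (Sub A AH); split=> //; apply: dist_le_refl. Qed.

Lemma rig_near_mono m n A B : m <= n -> rig_near m A B -> rig_near n A B.
Proof.
by move=> mn [a [b [ea eb ab]]]; exists a, b; split=> //; apply: dist_le_mono ab.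
Qed.

Lemma rig_near_sym n A B : rig_near n A B -> rig_near n B A.
Proof. by move=> [a [b [ea eb ab]]]; exists b, a; split=> //; apply: dist_le_sym. Qed.

Lemma rig_near_trans B m n A C : rig_near m A B -> rig_near n B C -> rig_near (m + n) A C.
Proof.
move=> [a [b [ea eb ab]]] [b' [c [eb' ec bc]]]; exists a, c; split=> //.
by apply: dist_le_trans ab _; rewrite (_ : b = b') //; apply: val_inj; rewrite eb.
Qed.

Lemma rig_near_meet A B v : A \in H -> B \in H -> v \in A -> v \in B -> rig_near 1 A B.
Proof.
move=> AH BH vA vB; have [AB|AB] := eqVneq A B.
  by rewrite -AB; apply: rig_near_refl.
exists (Sub A AH), (Sub B BH); split=> //; apply: dist_le_adj => /=.
rewrite /rig_adj /= -val_eqE /= AB /intersects; apply/set0Pn; exists v.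
by rewrite inE vA.
Qed.

Lemma rig_near1 A B : rig_near 1 A B -> A = B \/ exists2 v, v \in A & v \in B.
Proof.
case=> a [b [<- <- [p [+ <-]]]]; case: p => [|c [|//]]; first by left.
case/andP=> /andP[_ /set0Pn[v]]; rewrite inE => /andP[va vc] _ _.
by right; exists v.
Qed.

Lemma rig_near_mem n A B : rig_near n A B -> (A \in H) /\ (B \in H).
Proof. by move=> [a [b [<- <- _]]]; split; [exact: (valP a)|exact: (valP b)]. Qed.

End RigDistance.

(** * Levels of the members *)

Section Levels.
Variables (G : sgraph) (H : {set {set G}}).
Hypothesis H_spans : spans H.
Implicit Types A B C : {set G}.

Let meets : rel {set G} := [rel A B | [&& A \in H, B \in H & intersects A B]].

Let meets_sym : symmetric meets.
Proof. by move=> A B; rewrite /meets /= andbCA /intersects setIC. Qed.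

(** Walks of at most [n] steps as a boolean, so that [ex_minn] can extract the distance from the
    canonical [root] of the component. *)
Fixpoint reach n A B : bool :=
  if n is m.+1 then reach m A B || [exists C, reach m A C && meets C B]
  else A == B.

Lemma reach_ex A : exists n, reach n (root meets A) A.
Proof.
have : connect meets (root meets A) A.
  by rewrite (sym_connect_sym meets_sym); apply: connect_root.
move=> /connectP[p]; move: (root _ _) => B; elim/last_ind: p A => [|p C IH] A /=.
  by move=> _ ->; exists 0 => /=.
rewrite rcons_path last_rcons => /andP[Bp mC] ->.
have [n rn] := IH _ Bp erefl; exists n.+1 => /=; apply/orP; right.
by apply/existsP; exists (last B p); rewrite rn.
Qed.

Definition level A := ex_minn (reach_ex A).

Lemma level_le A B : meets A B -> level B <= (level A).+1.
Proof.
move=> AB; have rAB : root meets A = root meets B.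
  by apply/(rootP (sym_connect_sym meets_sym)); apply: connect1.
rewrite /level; case: ex_minnP => m _ minm; case: ex_minnP => n rn _.
apply: minm => /=; apply/orP; right; apply/existsP; exists A.
by rewrite -rAB rn.
Qed.

Lemma level_meet A B v : A \in H -> B \in H -> v \in A -> v \in B ->
  level A <= (level B).+1.
Proof.
move=> AH BH vA vB; apply: level_le; rewrite /meets /= AH BH /=.
by apply/set0Pn; exists v; rewrite inE vA vB.
Qed.

(** [B] is the last but one member on a shortest walk from the root to [A]. *)
Lemma level_pred A n : A \in H -> level A = n.+1 ->
  exists B v, [/\ B \in H, v \in A, v \in B & level B = n].
Proof.
move=> AH lA; suff [B BA lB] : exists2 B, meets B A & level B <= n.
  have /and3P[BH _ /set0Pn[v]] := BA; rewrite inE => /andP[vB vA].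
  exists B, v; split=> //; apply/eqP; rewrite eqn_leq lB.
  by have := level_le BA; rewrite lA ltnS.
move: lA; rewrite /level; case: ex_minnP => m rm minm mE; subst m.
move: rm => /= /orP[/minm|/existsP[C /andP[rC CA]]]; first by rewrite ltnn.
exists C => //; case: ex_minnP => k _; apply.
have -> // : root meets C = root meets A.
by apply/(rootP (sym_connect_sym meets_sym)); apply: connect1.
Qed.

(** As [H] spans, a walk in [G] lifts to a walk of successively meeting members. Hence both sets
    have the same root, and level 0 means being that root. *)
Lemma level0_unique A B a b : A \in H -> B \in H -> a \in A -> b \in B ->
  connect (@adj G) a b -> level A = 0 -> level B = 0 -> A = B.
Proof.
move=> AH BH aA bB ab; have rAB : root meets A = root meets B.
  apply/(rootP (sym_connect_sym meets_sym)).
  move: ab => /connectP[p ap bE]; subst b.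
  elim: p a A AH aA ap bB => [|c p IH] a A AH aA /=.
    move=> _ aB; apply: connect1; rewrite /meets /= AH BH.
    by apply/set0Pn; exists a; rewrite inE aA.
  case/andP=> ac cp lB; have [C CH /andP[aC cC]] := H_spans ac.
  apply: connect_trans (IH _ _ CH cC cp lB); apply: connect1.
  by rewrite /meets /= AH CH; apply/set0Pn; exists a; rewrite inE aA.
rewrite /level; case: ex_minnP => [[|//]] /= /eqP <- _ _.
by case: ex_minnP => [[|//]] /= /eqP <- _ _.
Qed.

End Levels.

(** * Layers *)

(* The K_{3,3} of [no_outer_K33]: edges [X i], [Y i] from [a i] to [x], [y], and
   [Z i] from [a i] to the added vertex. *)
Definition no_K33 (G : sgraph) (O : {set G}) : Prop :=
  forall (a : 'I_3 -> G) (x y : G) (X Y Z : 'I_3 -> {set G}),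
  (forall i, [/\ connected_vset (X i), connected_vset (Y i) & connected_vset (Z i)]) ->
  (forall i, [/\ a i \in X i, a i \in Y i & a i \in Z i]) ->
  (forall i, [/\ x \in X i, y \in Y i & exists2 v, v \in Z i & v \in O]) ->
  (forall i k, i != k ->
     [/\ [disjoint X i & Y k], [disjoint X i & Z k] & [disjoint Y i & Z k]]) ->
  False.

Lemma disjointPn (T : finType) (A B : {set T}) :
  (forall x, x \in A -> x \in B -> False) -> [disjoint A & B].
Proof.
move=> h; rewrite -setI_eq0; apply/eqP/setP => x; rewrite !inE.
by apply/negP => /andP[/h].
Qed.

(** [r] need not be transitive: take [x], and a [y] unrelated to it if there is one; an element
    related to neither would complete a forbidden triple. *)
Lemma at_most_two (T : Type) (I : T -> Prop) (r : T -> T -> Prop) :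
  (forall x y, r x y -> r y x) ->
  (forall f : 'I_3 -> T, (forall i, I (f i)) ->
     (forall i j, i != j -> ~ r (f i) (f j)) -> False) ->
  (exists x, I x) ->
  exists x y, [/\ I x, I y & forall z, I z -> r z x \/ r z y].
Proof.
move=> rsym no3 [x Ix].
have [[y [Iy nr]]|all1] := boolp.pselect (exists y, I y /\ ~ r y x); last first.
  exists x, x; split=> // z Iz; left; apply: boolp.contrapT => nzx.
  by apply: all1; exists z.
exists x, y; split=> // z Iz; apply: boolp.contrapT => /boolp.not_orP[nzx nzy].
apply: (no3 (tnth [tuple x; y; z])) => [i|i j ij rij].
  by case: i => [] [|[|[|//]]].
have ns a b : ~ r a b -> ~ r b a by move=> h /rsym.
move: i j ij rij => [] [|[|[|//]]] hi [] [|[|[|//]]] hj //= _;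
  by rewrite !(tnth_nth x) /=; do ?[exact: ns | done].
Qed.

Section Layers.
Variables (G : sgraph) (H : {set {set G}}) (O : {set G}).
Hypothesis H_connected : forall A, A \in H -> connected_vset A.
Hypothesis H_spans : spans H.
Hypothesis H_outer : forall A, A \in H -> exists2 v, v \in A & v \in O.
Hypothesis H_cover : forall v, exists2 A, A \in H & v \in A.
Hypothesis H_K33 : no_K33 O.
Implicit Types (A B C D T : {set G}) (u v w x y z : G).

Local Notation level := (@level G H).
Local Notation rig_near := (@rig_near G H).

Definition vball n := [set v | [exists A in H, (v \in A) && (level A < n)]].

Lemma vballP n v :
  reflect (exists A, [/\ A \in H, v \in A & level A < n]) (v \in vball n).
Proof.
rewrite inE; apply: (iffP exists_inP) => [[A AH /andP[vA lA]]|[A [AH vA lA]]].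
  by exists A.
by exists A => //; rewrite vA.
Qed.

Lemma member_vball A n v : A \in H -> level A < n -> v \in A -> v \in vball n.
Proof. by move=> AH lA vA; apply/vballP; exists A. Qed.

Lemma level_vball A n v : A \in H -> v \in A -> v \in vball n -> level A <= n.
Proof.
move=> AH vA /vballP[B [BH vB lB]].
by apply: leq_trans lB; apply: level_meet vA vB.
Qed.

Lemma vballS m n : m <= n -> vball m \subset vball n.
Proof.
move=> mn; apply/subsetP => v /vballP[A [AH vA lA]]; apply: member_vball vA => //.
exact: leq_trans mn.
Qed.

(** The complement of the filled ball: a component of the complement of [vball n] without a vertex
    of [O] is a pocket and is counted with the ball. *)
Definition live n :=
  [set v in ~: vball n | [exists w in O, connect (induced_adj (~: vball n)) v w]].

Lemma liveP n v : reflect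
  (v \notin vball n /\ exists2 w, w \in O & connect (induced_adj (~: vball n)) v w)
  (v \in live n).
Proof.
rewrite [v \in live n]in_set in_setC;
apply: (iffP andP) => [[nv /exists_inP[w wO vw]]|[nv [w wO vw]]].
  by split=> //; exists w.
by split=> //; apply/exists_inP; exists w.
Qed.

Lemma liveS m n : m <= n -> live n \subset live m.
Proof.
move=> mn; have ss : ~: vball n \subset ~: vball m by rewrite setCS vballS.
apply/subsetP => v /liveP[nv [w wO vw]]; apply/liveP; split.
  by apply: contraNN nv; apply/subsetP/vballS.
by exists w => //; apply: induced_connectS vw.
Qed.

Lemma live_connect n u v : u \in live n ->
  connect (induced_adj (~: vball n)) u v -> v \in live n.
Proof.
move=> /liveP[nu [w wO uw]] uv; apply/liveP; split.
  by have := induced_connect_mem uv; rewrite !in_setC => /(_ nu).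
by exists w => //; apply: connect_trans uw; rewrite induced_connect_sym.
Qed.

Lemma member_live A n v : A \in H -> [disjoint A & vball n] -> v \in A -> v \in live n.
Proof.
move=> AH dA vA; have [_ cA] := H_connected AH; have [w wA wO] := H_outer AH.
apply/liveP; split; first by rewrite (disjointFr dA vA).
exists w => //; apply: induced_connectS (cA _ _ vA wA).
by rewrite subsets_disjoint setCK.
Qed.

Lemma high_live A n v : A \in H -> n < level A -> v \in A -> v \in live n.
Proof.
move=> AH lA; apply: member_live => //; apply: disjointPn => x xA xb.
by have := level_vball AH xA xb; rewrite leqNgt lA.
Qed.

Lemma live0 v : v \in live 0.
Proof.
have [A AH vA] := H_cover v; apply: member_live vA => //.
by apply: disjointPn => x _ /vballP[B [_ _]].
Qed.

Lemma live_top v : exists k, v \notin live (4 * k).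
Proof.
have [A AH vA] := H_cover v; exists (level A).+1; apply/negP => /liveP[/negP[]].
by apply: member_vball vA => //; lia.
Qed.

(** Layers are numbered from 1, as [live 0] is everything: layer [k.+1] is [live (4 * k)] without
    [live (4 * k.+1)]. *)
Definition layer v := ex_minn (live_top v).

Lemma layer_gt v k : (k < layer v) = (v \in live (4 * k)).
Proof.
rewrite /layer; case: ex_minnP => m nm minm; apply/idP/idP => [km|vk].
  by apply: contraT => /minm; rewrite leqNgt km.
rewrite ltnNge; apply/negP => mk; move: nm; rewrite (subsetP (liveS _) _ vk) //.
by rewrite leq_mul2l.
Qed.

Lemma layer_pos v : 0 < layer v.
Proof. by rewrite layer_gt live0. Qed.

Lemma layer_vball v k : v \in vball (4 * k) -> layer v <= k.
Proof. by move=> vb; rewrite leqNgt layer_gt; apply/negP => /liveP[]; rewrite vb. Qed.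

Lemma layer_eq v k : v \in live (4 * k) -> v \notin live (4 * k.+1) -> layer v = k.+1.
Proof.
by rewrite -!layer_gt => h1 h2; apply/eqP; rewrite eqn_leq h1 leqNgt h2.
Qed.

Let same_layer : rel G := [rel u v | adj u v && (layer u == layer v)].

Let same_layer_sym : symmetric same_layer.
Proof. by move=> u v; rewrite /same_layer /= adj_sym eq_sym. Qed.

Definition part v := [set w | connect same_layer v w].

Lemma part_id v : v \in part v.
Proof. by rewrite inE connect0. Qed.

Lemma part_eq u v : v \in part u -> part v = part u.
Proof.
rewrite inE => uv; apply/setP => w; rewrite !inE.
by rewrite (same_connect (sym_connect_sym same_layer_sym) uv).
Qed.

Lemma part_layer u v : v \in part u -> layer v = layer u.
Proof.
rewrite inE => /connectP[p up ->]; elim: p u up => //= w p IH u /andP[/andP[_ /eqP ->]].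
exact: IH.
Qed.

Lemma part_adj u v : adj u v -> layer u = layer v -> part u = part v.
Proof.
move=> uv luv; apply/esym/part_eq; rewrite inE.
by apply: connect1; rewrite /same_layer /= uv luv eqxx.
Qed.

Lemma part_connected v : connected_vset (part v).
Proof.
split; first by apply/set0Pn; exists v; apply: part_id.
move=> x y xv yv; rewrite -(part_eq xv) in yv.
rewrite -(part_eq xv).
move: yv; rewrite inE => /connectP[p]; elim: p x {v xv} => [|z p IH] x /=.
  by move=> _ ->.
case/andP=> /andP[xz lxz] zp yE.
have zx : z \in part x by rewrite inE; apply: connect1; rewrite /same_layer /= xz.
rewrite -(part_eq zx); apply: connect_trans (IH _ zp yE); apply: connect1.
by apply/and3P; split=> //; [rewrite (part_eq zx)|]; apply: part_id.
Qed.

Lemma part_induced S u v :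
  (forall w, connect (induced_adj S) u w -> layer w = layer u) ->
  connect (induced_adj S) u v -> part u = part v.
Proof.
move=> lS /connectP[p]; elim: p u lS => [|z p IH] u lS /=.
  by move=> _ ->.
case/andP=> uz zp vE; have /and3P[_ _ auz] := uz.
have lz : layer z = layer u by apply: lS; apply: connect1.
rewrite (@part_adj _ z) //; apply: IH => // w zw.
by rewrite lz; apply: lS; apply: connect_trans (connect1 uz) zw.
Qed.

(** Levels of meeting members differ by at most 1, so a member above level [4 * k] avoids
    [vball (4 * k)]. Only members whose level is divisible by 4 can straddle two layers. *)
Lemma mid_layer A k v : A \in H -> 4 * k < level A < 4 * k.+1 -> v \in A ->
  layer v = k.+1.
Proof.
move=> AH /andP[l1 l2] vA; apply: layer_eq; first exact: high_live vA.
by apply/negP => /liveP[/negP[]]; apply: member_vball vA.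
Qed.

Lemma mid_part A k u v : A \in H -> 4 * k < level A < 4 * k.+1 ->
  u \in A -> v \in A -> part u = part v.
Proof.
move=> AH lA uA vA; have [_ cA] := H_connected AH.
apply: (part_induced _ (cA _ _ uA vA)) => w uw.
by rewrite !(@mid_layer A k) // (induced_connect_mem uw).
Qed.

(** If [v] lies in a pocket, a member through [v] must leave that pocket, since it would otherwise
    connect [v] to the outer face. It leaves through the ball, and up to its first vertex [y] in the
    ball it stays in the layer of [v]. *)
Lemma part_vball v k : layer v = k.+1 -> exists2 y, part y = part v &
  y \in vball (4 * k.+1) /\ exists2 A, A \in H & (v \in A) && (y \in A).
Proof.
move=> lv; have [vb|nvb] := boolP (v \in vball (4 * k.+1)).
  by have [A AH vA] := H_cover v; exists v => //; split=> //; exists A; rewrite // vA.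
have dead : v \notin live (4 * k.+1) by rewrite -layer_gt lv ltnn.
have lk : v \in live (4 * k) by rewrite -layer_gt lv.
have [A AH vA] := H_cover v.
have hA : 4 * k.+1 <= level A.
  by rewrite leqNgt; apply: contra nvb => h; apply: member_vball vA.
have [w wA wb] : exists2 w, w \in A & w \in vball (4 * k.+1).
  apply/exists_inP; apply: contraT => /exists_inPn no; case/negP: dead.
  by apply: member_live vA => //; apply: disjointPn => x /no/negP.
have [x [y [vx xS yA yb xy]]] := first_hit (H_connected AH) vA nvb wA wb.
have live4 z : z \in A -> z \in live (4 * k).
  by apply: high_live => //; apply: leq_trans hA; rewrite ltn_pmul2l.
have lz z : connect (induced_adj (A :\: vball (4 * k.+1))) v z -> z \in A ->
    layer z = k.+1.
  move=> vz zA; apply: layer_eq; first exact: live4.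
  apply: contra dead => zl; apply: live_connect zl _; rewrite induced_connect_sym.
  by apply: induced_connectS vz; rewrite setDE subsetIr.
have ly : layer y = k.+1.
  by apply: layer_eq; [exact: live4|apply/negP => /liveP[]; rewrite yb].
have xA : x \in A by case/setDP: xS.
exists y; last by split=> //; exists A; rewrite // vA.
rewrite -(@part_adj x y) //; last by rewrite lz.
apply/esym; apply: part_induced vx => z vz; rewrite lv; apply: lz => //.
by have := induced_connect_mem vz; rewrite !in_setD nvb vA => /(_ isT)/andP[].
Qed.

Lemma member_part_outer A k v y : A \in H -> 4 * k < level A < 4 * k.+1 ->
  y \in A -> part y = part v -> exists2 w, w \in part v & w \in O.
Proof.
move=> AH lA yA yv; have [w wA wO] := H_outer AH; exists w => //.
by rewrite -yv (mid_part AH lA yA wA) part_id.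
Qed.

(** It suffices that the part meets a member of level strictly between [4 * k] and [4 * k.+1]: such
    a member lies inside the part and reaches the outer face. *)
Lemma part_outer v : exists2 w, w \in part v & w \in O.
Proof.
case lv: (layer v) (layer_pos v) => [//|k] _.
have [y yv [yb _]] := part_vball lv.
have ly : layer y = k.+1 by rewrite -lv; apply: part_layer; rewrite -yv part_id.
have yl : y \in live (4 * k) by rewrite -layer_gt ly.
have [yb1|nyb1] := boolP (y \in vball (4 * k).+1); last first.
  have /vballP[A [AH yA lA]] := yb; apply: (@member_part_outer A k v y) => //.
  rewrite lA andbT ltnNge; apply: contra nyb1 => h.
  exact: member_vball yA.
(* In the remaining case [y] is in a member of level [4 * k]. Its component [S] outside
   [vball (4 * k)] reaches the outer face because [y] is live. *)
pose S := [set z | connect (induced_adj (~: vball (4 * k))) y z].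
have [nyb [w wO yw]] := liveP _ _ yl.
have SC z : z \in S -> z \in live (4 * k).
  by rewrite in_set; apply: live_connect.
have cS : connected_vset S.
  split; first by apply/set0Pn; exists y; rewrite in_set connect0.
  suff toS z : z \in S -> connect (induced_adj S) y z.
    move=> z t zS tS; apply: (@connect_trans _ _ y); last exact: toS.
    by rewrite induced_connect_sym; apply: toS.
  rewrite in_set => /connectP[p yp ->].
  suff walk q x : path (induced_adj (~: vball (4 * k))) x q -> x \in S ->
      connect (induced_adj S) x (last x q).
    by apply: walk yp _; rewrite in_set connect0.
  elim: q x => //= t q IH x /andP[xt tq] xS.
  have tS : t \in S.
    by rewrite in_set in xS; rewrite in_set; apply: connect_trans xS (connect1 xt).
  apply: connect_trans (IH _ tq tS); apply: connect1.
  by rewrite /induced_adj /= xS tS; case/and3P: xt.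
have layer_small z : z \in S -> z \in vball (4 * k).+1 -> layer z = k.+1.
  move=> /SC zl zb; apply: layer_eq => //; apply/negP => /liveP[/negP[]].
  by apply: (subsetP (vballS _)) zb; rewrite mulnS -add1n leq_add2r.
(* If [S] stays inside the next ball, it lies in a single layer and its outer vertex [w] belongs to
   the part. *)
have [wb|nwb] := boolP (S \subset vball (4 * k).+1).
  exists w => //; rewrite -yv.
  suff -> : part y = part w by apply: part_id.
  have wS : w \in S by rewrite in_set.
  have yS : y \in S by rewrite in_set connect0.
  apply: (part_induced _ (cS.2 _ _ yS wS)) => z yz.
  have zS := induced_connect_mem yz yS.
  by rewrite ly; apply: layer_small => //; apply: (subsetP wb).
(* Otherwise an edge from [x] to [z] leaves [vball (4 * k).+1]; a member containing both ends has
   level exactly [(4 * k).+1]. *)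
have [t tS ntb] := subsetPn nwb.
have yS : y \in S by rewrite in_set connect0.
pose Z := ~: vball (4 * k).+1.
have [||x [z [yx xS zS zZ xz]]] := @first_hit G S Z y t cS yS _ tS.
- by rewrite in_setC negbK.
- by rewrite in_setC.
have xb : x \in vball (4 * k).+1 by case/setDP: xS; rewrite in_setC negbK.
have xy : part x = part y.
  apply/esym; apply: part_induced yx => z' yz'.
  have : z' \in S :\: Z.
    by apply: induced_connect_mem yz' _; rewrite in_setD yS in_setC negbK yb1.
  by case/setDP=> z'S; rewrite in_setC negbK ly; apply: layer_small.
have [A AH /andP[xA zA]] := H_spans xz.
apply: (@member_part_outer A k v x) => //; last by rewrite xy.
have h1 := level_vball AH xA xb.
have h2 : ~~ (level A < (4 * k).+1).
  by apply/negP => h; move: zZ; rewrite in_setC; case/negP; apply: member_vball zA.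
by move: h1 h2; clear; lia.
Qed.

(** Descend from [B] one level at a time. Members strictly above level [4 * k] stay in the part, and
    from level [4 * k] the last step enters [vball (4 * k)] across an edge leaving the part. As
    [level B] is at most [4 * k + 3], four steps suffice. For [k = 0] the predecessor truncates and
    the descent ends at a member of level 0. *)
Lemma rig_near_interface B y k : B \in H -> y \in B -> layer y = k.+1 ->
  level B < 4 * k.+1 ->
  exists2 C, rig_near 4 B C & level C = (4 * k).-1 /\
    (0 < k -> exists x q, [/\ x \in C, q \in part y & adj x q]).
Proof.
move=> BH yB ly lB.
suff: exists2 C, rig_near ((level B).+1 - 4 * k) B C & level C = (4 * k).-1 /\
    (0 < k -> exists x q, [/\ x \in C, q \in part y & adj x q]).
  by case=> C nC h; exists C => //; apply: rig_near_mono nC; move: lB; clear; lia.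
have yl : y \in live (4 * k) by rewrite -layer_gt ly.
have [nyb _] := liveP _ _ yl.
have lB0 : 4 * k <= level B.
  by rewrite leqNgt; apply: contra nyb => h; apply: member_vball yB.
move mE : (level B - 4 * k) => m.
elim: m B y BH yB ly lB mE yl nyb lB0 => [|m IH] B y BH yB ly lB mE yl nyb lB0.
  have lE : level B = 4 * k by move: lB0 mE; clear; lia.
  case: k => [|k] in ly lB mE yl nyb lB0 lE *.
    by exists B; [apply: rig_near_refl|split].
  have [|C0 [w [C0H wB wC0 lC0]]] := @level_pred G H B (4 * k).+3 BH.
    by move: lE; clear; lia.
  have wb : w \in vball (4 * k.+1).
    by apply: member_vball wC0 => //; move: lC0; clear; lia.
  have [x [z [yx xS zB zb xz]]] := first_hit (H_connected BH) yB nyb wB wb.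
  have /vballP[C [CH zC lC]] := zb.
  have lC' := level_meet BH CH zB zC.
  exists C.
    by apply: rig_near_mono (rig_near_meet BH CH zB zC); move: lE; clear; lia.
  split; first by move: lC lC' lE; clear; lia.
  move=> _; exists z, x; split=> //; last by rewrite adj_sym.
  suff -> : part y = part x by apply: part_id.
  apply: part_induced yx => t yt; rewrite ly.
  have tB : t \in B.
    have : t \in B :\: vball (4 * k.+1).
      by apply: induced_connect_mem yt _; rewrite in_setD nyb.
    by case/setDP.
  apply: layer_eq.
    apply: live_connect yl _; apply: induced_connectS yt.
    by rewrite setDE subsetIr.
  by apply/negP => /liveP[/negP[]]; apply: member_vball tB => //; move: lE; clear; lia.
have lmid : 4 * k < level B < 4 * k.+1 by move: lB mE; clear; lia.
have [|C [w [CH wB wC lC]]] := @level_pred G H B (level B).-1 BH.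
  by move: lmid; clear; lia.
have lw := mid_layer BH lmid wB.
have wl : w \in live (4 * k) by rewrite -layer_gt lw.
have [nwb _] := liveP _ _ wl.
have [|||D nD [lD hD]] := IH C w CH wC lw _ _ wl nwb _;
  try by move: lC lmid mE; clear; lia.
exists D.
  apply: rig_near_mono (rig_near_trans (rig_near_meet BH CH wB wC) nD).
  by move: lC lmid; clear; lia.
by split=> //; rewrite (mid_part BH lmid yB wB).
Qed.

Lemma part_interface v k : layer v = k.+1 ->
  exists A C, [/\ A \in H, v \in A, rig_near 5 A C, level C = (4 * k).-1 &
    (0 < k -> exists x q, [/\ x \in C, q \in part v & adj x q])].
Proof.
move=> lv; have [y yv [yb [A AH /andP[vA yA]]]] := part_vball lv.
have ly : layer y = k.+1 by rewrite -lv; apply: part_layer; rewrite -yv part_id.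
have /vballP[B [BH yB lB]] := yb.
have [C nC [lC hC]] := rig_near_interface BH yB ly lB.
exists A, C; split=> //; last by rewrite -yv.
exact: rig_near_trans (rig_near_meet AH BH yA yB) nC.
Qed.

(** [T] is the union of a descending chain of members from [A] to its root. The distance estimate
    says that the upper members of the tower are close to [A], which keeps them away from members
    far from [A]. *)
Lemma tower A : A \in H -> exists T C,
  [/\ connected_vset T, A \subset T, C \in H, level C = 0 & C \subset T] /\
  forall u, u \in T -> exists B,
    [/\ B \in H, u \in B, level B <= level A & rig_near (level A - level B) A B].
Proof.
move=> AH; move lE : (level A) => n; elim: n A AH lE => [|n IH] A AH lE.
  exists A, A; split; first by split=> //; apply: H_connected.
  by move=> u uA; exists A; rewrite lE; split=> //; apply: rig_near_refl.
have [B [w [BH wA wB lB]]] := level_pred AH lE.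
have [T [C [[cT BT CH lC CT] hT]]] := IH B BH lB.
exists (A :|: T), C; split.
  split=> //; last by apply: subset_trans CT (subsetUr _ _).
    apply: (@connected_vsetU G A T w w) => //; rewrite ?eqxx //.
      exact: H_connected.
    exact: (subsetP BT).
  exact: subsetUl.
move=> u /setUP[uA|/hT[D [DH uD lD nD]]].
  by exists A; rewrite lE; split=> //; apply: rig_near_refl.
exists D; split=> //; first by move: lD; clear; lia.
apply: rig_near_mono (rig_near_trans (rig_near_meet AH BH wA wB) nD).
by move: lD; clear; lia.
Qed.

(** The configuration refuted by [H_K33]: towers lead from [C i] to the common root,
    [C i :|: part v] leads to [v], and [C i] itself reaches the outer face. The sets [Y i] all
    contain [part v], which is allowed because their edges share an end. *)
Lemma interface_clusters v k (C : 'I_3 -> {set G}) : layer v = k.+1 -> 0 < k ->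
  (forall i, [/\ C i \in H, level (C i) = (4 * k).-1 &
     exists x q, [/\ x \in C i, q \in part v & adj x q]]) ->
  (forall i j, i != j -> ~ rig_near 2 (C i) (C j)) -> False.
Proof.
move=> lv k0 hC far.
have CH i : C i \in H by case: (hC i).
have lC i : level (C i) = (4 * k).-1 by case: (hC i).
have Cq i : exists x q, [/\ x \in C i, q \in part v & adj x q] by case: (hC i).
have /fin_all_exists[x xP] := Cq.
have /fin_all_exists[T TP] := fun i => tower (CH i).
have /fin_all_exists[r rP] := TP.
have xC i : x i \in C i by have [q []] := xP i.
have CT i : C i \subset T i by case: (rP i) => -[].
have QNb u : u \in part v -> u \notin vball (4 * k).
  by move=> /part_layer uv; have : u \in live (4 * k);
    [rewrite -layer_gt uv lv|case/liveP].
have ball_of A u : A \in H -> level A <= (4 * k).-1 -> u \in A -> u \in vball (4 * k).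
  by move=> AH lA uA; apply: member_vball uA => //; move: lA k0; clear; lia.
have conn i : connected_vset (C i :|: part v).
  have [q [_ qv xq]] := xP i.
  apply: (@connected_vsetU G _ _ (x i) q) => //; last by rewrite xq orbT.
    exact: H_connected.
  exact: part_connected.
have cT i : connected_vset (T i) by case: (rP i) => -[].
have rH i : r i \in H by case: (rP i) => -[].
have l0 i : level (r i) = 0 by case: (rP i) => -[].
have rT i : r i \subset T i by case: (rP i) => -[].
have hT i u : u \in T i -> exists B, [/\ B \in H, u \in B, level B <= (4 * k).-1 &
   rig_near ((4 * k).-1 - level B) (C i) B].
  by case: (rP i) => _ h /h; rewrite lC.
have [z zr] : exists z, z \in r ord0.
  by have [/set0Pn[z zr] _] := H_connected (rH ord0); exists z.
have rE i : r i = r ord0.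
  have [/set0Pn[t tr] _] := H_connected (rH i).
  apply: (@level0_unique G H H_spans _ _ t z) => //.
  have to j u : u \in T j -> connect (@adj G) v u.
    move=> uT; apply: (@connect_trans _ _ (x j)).
      apply: (@induced_connect_adj G (C j :|: part v)).
      by apply: (conn j).2; rewrite in_setU ?part_id ?orbT ?xC.
    apply: (@induced_connect_adj G (T j)); apply: (cT j).2 => //.
    exact: (subsetP (CT j)).
  apply: (@connect_trans _ _ v); last by apply: (to ord0); apply: (subsetP (rT _)).
  rewrite (sym_connect_sym (@adj_sym G)); apply: (to i).
  exact: (subsetP (rT _)).
(* A tower member [B] meeting [C j] is at most one level below [C i], hence within distance 1 of it;
   then [C i] and [C j] would be within 2. *)
have TC i j u : i != j -> u \in T i -> u \in C j -> False.
  move=> ij /hT[B [BH uB lB nB]] uC; apply: (far _ _ ij).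
  have lm := level_meet (CH j) BH uC uB; rewrite lC in lm.
  apply: (rig_near_trans (m := 1) (n := 1) _ (rig_near_meet BH (CH j) uB uC)).
  by apply: rig_near_mono nB; move: lm; clear; lia.
have TQ i u : u \in T i -> u \in part v -> False.
  by move=> /hT[B [BH uB lB _]] /QNb/negP[]; apply: ball_of uB.
apply: (H_K33 (a := x) (x := z) (y := v) (X := T) (Y := fun i => C i :|: part v)
  (Z := C)).
- by move=> i; split=> //; apply: H_connected.
- by move=> i; split=> //; [apply: (subsetP (CT i))|rewrite in_setU xC].
- move=> i; split; first by apply: (subsetP (rT i)); rewrite rE.
    by rewrite in_setU part_id orbT.
  exact: H_outer.
move=> i j ij; split; apply: disjointPn => u.
- by move=> uT /setUP[]; [apply: TC ij uT|apply: TQ uT].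
- exact: TC ij.
- move=> /setUP[uC uC'|uv uC'].
    by apply: (TC _ _ _ ij _ uC'); apply: (subsetP (CT i)).
  by apply: (TQ j) uv; apply: (subsetP (CT j)).
Qed.

(** Again [H_K33], with branch vertices [w i]. The towers start at [D i], two levels below [A], and
    so avoid [A]. Thickness 4 enters here: the levels [(4 * k).+1] to [(4 * k).+3] are interior to
    the layer, so members at these levels lie in one part each. *)
Lemma crossing_parts A k (x : 'I_3 -> G) : A \in H -> level A = 4 * k.+1 ->
  (forall i, [/\ x i \in A, x i \in vball (4 * k.+1) & layer (x i) = k.+1]) ->
  (forall i j, i != j -> part (x i) <> part (x j)) -> False.
Proof.
move=> AH lA hx far.
have xA i : x i \in A by case: (hx i).
have /fin_all_exists[C CP] : forall i, exists B,
    [/\ B \in H, x i \in B & level B = (4 * k).+3].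
  move=> i; have [xiA /vballP[B [BH xB lB]] _] := hx i; exists B; split=> //.
  by have := level_meet AH BH xiA xB; move: lB lA; clear; lia.
have CH i : C i \in H by case: (CP i).
have xC i : x i \in C i by case: (CP i).
have lC i : level (C i) = (4 * k).+3 by case: (CP i).
have /fin_all_exists[D /fin_all_exists[w DP]] := fun i => level_pred (CH i) (lC i).
have DH i : D i \in H by case: (DP i).
have wC i : w i \in C i by case: (DP i).
have wD i : w i \in D i by case: (DP i).
have lD i : level (D i) = (4 * k).+2 by case: (DP i).
have /fin_all_exists[T /fin_all_exists[r rP]] := fun i => tower (DH i).
have DT i : D i \subset T i by case: (rP i) => -[].
have cT i : connected_vset (T i) by case: (rP i) => -[].
have rH i : r i \in H by case: (rP i) => -[].
have l0 i : level (r i) = 0 by case: (rP i) => -[].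
have rT i : r i \subset T i by case: (rP i) => -[].
have hT i u : u \in T i -> exists B, [/\ B \in H, u \in B, level B <= (4 * k).+2 &
   rig_near ((4 * k).+2 - level B) (D i) B].
  by case: (rP i) => _ h /h; rewrite lD.
have pC i u : u \in C i -> part u = part (x i).
  by move=> uC; apply: (@mid_part (C i) k) => //; rewrite lC; clear; lia.
have pD i u : u \in D i -> part u = part (x i).
  move=> uD; rewrite -(pC i _ (wC i)); apply: (@mid_part (D i) k) => //.
  by rewrite lD; clear; lia.
(* The top two levels of a tower remain in [part (x i)]; lower members of it are too deep to meet
   any [C j] or [D j]. *)
have pB B i u : B \in H -> u \in B -> 4 * k < level B <= (4 * k).+2 ->
    rig_near ((4 * k).+2 - level B) (D i) B -> part u = part (x i).
  move=> BH uB lB nB; have : rig_near 1 (D i) B.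
    by apply: rig_near_mono nB; move: lB; clear; lia.
  case/rig_near1 => [DB|[t tD tB]]; first by apply: pD; rewrite DB.
  rewrite -(pD i _ tD); apply: (@mid_part B k) => //.
  by move: lB; clear; lia.
have TC i j u : i != j -> u \in T i -> u \in C j -> False.
  move=> ij /hT[B [BH uB lB nB]] uC; apply: (far _ _ ij).
  have lm := level_meet (CH j) BH uC uB; rewrite lC in lm.
  rewrite -(pC j _ uC); apply/esym; apply: pB uB _ nB => //.
  by move: lm lB; clear; lia.
have TD i j u : i != j -> u \in T i -> u \in D j -> False.
  move=> ij /hT[B [BH uB lB nB]] uD; apply: (far _ _ ij).
  have lm := level_meet (DH j) BH uD uB; rewrite lD in lm.
  rewrite -(pD j _ uD); apply/esym; apply: pB uB _ nB => //.
  by move: lm lB; clear; lia.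
have TA i u : u \in T i -> u \in A -> False.
  move=> /hT[B [BH uB lB nB]] uA.
  by have := level_meet AH BH uA uB; rewrite lA; move: lB; clear; lia.
have cACD i : connected_vset (A :|: (C i :|: D i)).
  apply: (@connected_vsetU G _ _ (x i) (x i)); rewrite ?eqxx ?in_setU ?xC //.
    exact: H_connected.
  by apply: (@connected_vsetU G _ _ (w i) (w i)); rewrite ?eqxx //; apply: H_connected.
have [z zr] : exists z, z \in r ord0.
  by have [/set0Pn[z zr] _] := H_connected (rH ord0); exists z.
have rE i : r i = r ord0.
  have [/set0Pn[t tr] _] := H_connected (rH i).
  apply: (@level0_unique G H H_spans _ _ t z) => //.
  have to j u : u \in T j -> connect (@adj G) (x ord0) u.
    move=> uT; apply: (@connect_trans _ _ (w j)).
      apply: (@induced_connect_adj G (A :|: (C j :|: D j))).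
      by apply: (cACD j).2; rewrite !in_setU ?wD ?xA ?orbT.
    apply: (@induced_connect_adj G (T j)); apply: (cT j).2 => //.
    exact: (subsetP (DT j)).
  apply: (@connect_trans _ _ (x ord0)); last by apply: (to ord0); apply: (subsetP (rT _)).
  rewrite (sym_connect_sym (@adj_sym G)); apply: (to i).
  exact: (subsetP (rT _)).
apply: (H_K33 (a := w) (x := z) (y := x ord0) (X := T)
  (Y := fun i => A :|: (C i :|: D i)) (Z := D)).
- by move=> i; split=> //; apply: H_connected.
- by move=> i; split=> //; [apply: (subsetP (DT i))|rewrite !in_setU wD !orbT].
- move=> i; split; first by apply: (subsetP (rT i)); rewrite rE.
    by rewrite in_setU xA.
  exact: H_outer.
move=> i j ij; split; apply: disjointPn => u.
- by move=> uT /setUP[/(TA i)|/setUP[]]; [exact|apply: TC ij uT|apply: TD ij uT].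
- exact: TD ij.
- move=> + uD; have uTj : u \in T j by apply: (subsetP (DT j)).
  rewrite eq_sym in ij.
  case/setUP=> [/(TA j)|/setUP[]]; [exact|apply: TC ij uTj|apply: TD ij uTj].
Qed.

Lemma rig_near_connect n A B a b : rig_near n A B -> a \in A -> b \in B ->
  connect (@adj G) a b.
Proof.
move=> [c [d [<- <- [p [cp <- _]]]]]; elim: p c a cp => [|e p IH] c a /=.
  move=> _ ac bc; apply: (@induced_connect_adj G (val c)).
  by apply: (H_connected (valP c)).2.
case/andP=> /andP[_ /set0Pn[t /setIP[tc te]]] ep ac bl.
apply: connect_trans (IH _ _ ep te bl).
by apply: (@induced_connect_adj G (val c)); apply: (H_connected (valP c)).2.
Qed.

(** Every vertex of the part is near an interface member just below the layer, and by
    [interface_clusters] these members gather around two of them. Then [two_clusters] with [c = 9]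
    and [a = 2] gives [4 * 9 + 2 = 38]. *)
Lemma part_diameter v A B : A \in H -> B \in H ->
  intersects A (part v) -> intersects B (part v) -> rig_near 38 A B.
Proof.
move=> AH BH /set0Pn[a /setIP[aA av]] /set0Pn[b /setIP[bB bv]].
(* Quantifying over all members through [u] and [w] turns the distance of members into one of
   vertices. *)
pose D n u w := forall A B, A \in H -> B \in H -> u \in A -> w \in B -> rig_near n A B.
suff [p [q pq]] : exists p q, forall u, u \in part v -> D 9 u p \/ D 9 u q.
  have : D (4 * 9 + 2) a b; last exact.
  apply: (@two_clusters G (part v) D 2 9 p q) => //.
  - exact: part_connected.
  - by move=> n u w uw X Y XH YH uX wY; apply: rig_near_sym; apply: uw.
  - move=> m n u w z uw wz X Z XH ZH uX zZ; have [Y YH wY] := H_cover w.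
    by apply: rig_near_trans (uw _ _ XH YH uX wY) (wz _ _ YH ZH wY zZ).
  - by move=> m n u w mn uw X Y XH YH uX wY; apply: rig_near_mono mn _; apply: uw.
  - move=> u w _ _ uw X Y XH YH uX wY; have [Z ZH /andP[uZ wZ]] := H_spans uw.
    exact: rig_near_trans (rig_near_meet XH ZH uX uZ) (rig_near_meet ZH YH wZ wY).
(* The constant is [1 + 5 + 2 + 1]: from [Y] to [X], down to [C'], across to [C], and on to [Z]. *)
have DI u c C C' : u \in part v -> c \in C -> C \in H ->
    (exists2 X, (X \in H) && (u \in X) & rig_near 5 X C') -> rig_near 2 C' C -> D 9 u c.
  move=> uv cC CH [X /andP[XH uX] XC'] C'C Y Z YH ZH uY cZ.
  apply: rig_near_trans (rig_near_meet YH XH uY uX)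
    (rig_near_trans XC' (rig_near_trans C'C _)).
  exact: rig_near_meet cC cZ.
have lpart u : u \in part v -> layer u = layer v by apply: part_layer.
case lv: (layer v) (layer_pos v) => [//|[|k]] _.
  (* In the lowest layer the interface member has level 0 and is unique, so a single cluster
     suffices. *)
  have [X [C [XH vX nC lC _]]] := part_interface lv.
  have [_ CH] := rig_near_mem nC.
  have [/set0Pn[c cC] _] := H_connected CH.
  exists c, c => u uv; left.
  have lu : layer u = 1 by rewrite lpart // lv.
  have [Y [C' [YH uY nC' lC' _]]] := part_interface lu.
  have [_ C'H] := rig_near_mem nC'.
  have [/set0Pn[c' c'C'] _] := H_connected C'H.
  apply: (DI u c C C') => //; first by exists Y; rewrite ?YH.
  suff -> : C' = C by apply: rig_near_refl.
  apply: (@level0_unique G H H_spans _ _ c' c) => //.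
  apply: (@connect_trans _ _ u).
    by apply: rig_near_connect (rig_near_sym nC') c'C' uY.
  apply: (@connect_trans _ _ v); last exact: rig_near_connect nC vX cC.
  apply: (@induced_connect_adj G (part v)).
  by apply: (part_connected v).2 => //; apply: part_id.
pose I C := [/\ C \in H, level C = (4 * k.+1).-1 &
     exists x q, [/\ x \in C, q \in part v & adj x q]].
have IP u : u \in part v -> exists2 C, I C &
    exists2 X, (X \in H) && (u \in X) & rig_near 5 X C.
  move=> uv; have lu : layer u = k.+2 by rewrite lpart // lv.
  have [X [C [XH uX nC lC /(_ isT) hC]]] := part_interface lu.
  rewrite (part_eq uv) in hC.
  exists C; last by exists X; rewrite ?XH.
  by split=> //; case: (rig_near_mem nC).
have [|||C1 [C2 [I1 I2 I12]]] := @at_most_two {set G} I (rig_near 2).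
- by move=> X Y; apply: rig_near_sym.
- by move=> f If; apply: (@interface_clusters v k.+1).
- by have [C IC _] := IP v (part_id v); exists C.
have [C1H _ _] := I1; have [C2H _ _] := I2.
have [/set0Pn[c1 c1C] _] := H_connected C1H.
have [/set0Pn[c2 c2C] _] := H_connected C2H.
exists c1, c2 => u uv; have [C IC XC] := IP u uv.
by have [h|h] := I12 _ IC; [left; apply: (DI u c1 C1 C)|right; apply: (DI u c2 C2 C)].
Qed.

Definition parts := [set part v | v in [set: G]].

Lemma part_in v : part v \in parts.
Proof. exact: imset_f. Qed.

Definition part_vertex v : IM parts := Sub (part v) (part_in v).

Lemma part_vertex_eq u v : part u = part v -> part_vertex u = part_vertex v.
Proof. by move=> uv; apply: val_inj. Qed.

Lemma part_vertex_adj u v : adj u v -> dist_le (part_vertex u) (part_vertex v) 1.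
Proof.
move=> uv; have [E|N] := eqVneq (part_vertex u) (part_vertex v).
  by rewrite E; apply: dist_le_refl.
apply: dist_le_adj; rewrite /= /im_adj /= N; apply/exists_inP; exists u.
  exact: part_id.
by apply/exists_inP; exists v => //; apply: part_id.
Qed.

(** A member meets only layers [k] and [k.+1]. If it meets the lower one, its level is [4 * k] and
    each of its vertices is in, or one step from, a lower part that contains a vertex of [A] in the
    ball. By [crossing_parts] there are at most two such parts, and [two_clusters] gives
    [4 * 1 + 1 = 5]. *)
Lemma member_parts A u v : A \in H -> u \in A -> v \in A ->
  dist_le (part_vertex u) (part_vertex v) 9.
Proof.
move=> AH uA vA; have cA := H_connected AH.
pose k := level A %/ 4.
have lAk : 4 * k <= level A < 4 * k.+1.
  rewrite /k; clear; move: (level A) => n.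
  by have := divn_eq n 4; have := ltn_pmod n (isT : 0 < 4); lia.
have low w : w \in A -> layer w <= k.+1.
  by move=> wA; apply: layer_vball; apply: member_vball wA => //; case/andP: lAk.
have high w : w \in A -> k <= layer w.
  move=> wA; case: (posnP k) => [->//|k0].
  rewrite -(prednK k0) layer_gt; apply: high_live wA => //.
  by move: lAk k0; clear; lia.
have [all1|[x xA lx]] : (forall w, w \in A -> layer w = k.+1) \/
    exists2 x, x \in A & layer x = k.
  have [/existsP[x /andP[xA /eqP lx]]|/existsPn no] :=
    boolP [exists x, (x \in A) && (layer x == k)]; first by right; exists x.
  left=> w wA; have := no w; rewrite wA /= => nk.
  by apply/eqP; rewrite eqn_leq low // ltn_neqAle eq_sym nk high.
  have -> : part_vertex u = part_vertex v; last exact: dist_le_refl.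
  apply: part_vertex_eq; apply: part_induced (cA.2 _ _ uA vA) => w uw.
  by rewrite !all1 // (induced_connect_mem uw).
have k0 : 0 < k by rewrite -lx layer_pos.
have lA : level A = 4 * k.
  apply/eqP; rewrite eqn_leq; case/andP: lAk => -> _; rewrite andbT leqNgt.
  apply/negP => h; have : k < layer x by rewrite layer_gt; apply: high_live xA.
  by rewrite lx ltnn.
pose I w := [/\ w \in A, w \in vball (4 * k) & layer w = k].
(* The pocket argument of [part_vball], now carried out inside [A]. *)
have base w : w \in A -> layer w = k -> exists2 y, I y & part w = part y.
  move=> wA lw; have [wb|nwb] := boolP (w \in vball (4 * k)); first by exists w.
  have dead : w \notin live (4 * k) by rewrite -layer_gt lw ltnn.
  have [t tA tb] : exists2 t, t \in A & t \in vball (4 * k).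
    apply/exists_inP; apply: contraT => /exists_inPn no; case/negP: dead.
    by apply: member_live wA => //; apply: disjointPn => z /no/negP.
  have [z [y [wz zS yA yb zy]]] := first_hit cA wA nwb tA tb.
  have ly : layer y = k by apply/eqP; rewrite eqn_leq high // layer_vball.
  have lz z' : connect (induced_adj (A :\: vball (4 * k))) w z' -> layer z' = k.
    move=> wz'; have : z' \in A :\: vball (4 * k).
      by apply: induced_connect_mem wz' _; rewrite in_setD nwb.
    case/setDP=> z'A _; apply/eqP; rewrite eqn_leq high // andbT leqNgt layer_gt.
    apply: contra dead => zl; apply: live_connect zl _; rewrite induced_connect_sym.
    by apply: induced_connectS wz'; rewrite setDE subsetIr.
  exists y => //; rewrite -(@part_adj z y) //; last by rewrite lz.
  by apply: part_induced wz => z' /lz ->.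
have anchor w : w \in A -> exists2 y, I y & dist_le (part_vertex w) (part_vertex y) 1.
  move=> wA; have [lw|nlw] := eqVneq (layer w) k.
    have [y Iy wy] := base w wA lw; exists y => //.
    by rewrite (part_vertex_eq wy); apply: dist_le_refl.
  have [||z [y [wz zS yA yb zy]]] := @first_hit G A [set t | layer t == k] w x cA wA _ xA.
  - by rewrite in_set.
  - by rewrite in_set lx.
  rewrite in_set in yb; have [y' Iy' yy'] := base y yA (eqP yb).
  exists y' => //; rewrite -(part_vertex_eq yy').
  have -> : part_vertex w = part_vertex z; last exact: part_vertex_adj.
  apply: part_vertex_eq; apply: part_induced wz => t wt.
  have up s : s \in A -> layer s != k -> layer s = k.+1.
    by move=> sA ns; apply/eqP; rewrite eqn_leq low // ltn_neqAle eq_sym ns high.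
  have : t \in A :\: [set t | layer t == k].
    by apply: induced_connect_mem wt _; rewrite in_setD in_set nlw.
  by rewrite in_setD in_set => /andP[nt tA]; rewrite (up t) // (up w).
have [|||x1 [x2 [I1 I2 I12]]] := @at_most_two G I (fun x y => part x = part y).
- by move=> *; apply: esym.
- move=> f If nf; apply: (@crossing_parts A k.-1 f) => //; first by rewrite prednK.
  by move=> i; rewrite prednK //; apply: If.
- by have [y Iy _] := base x xA lx; exists y.
apply: dist_le_mono (_ : 4 * 1 + 1 <= 9) _ => //.
apply: (@two_clusters G A (fun n u v => dist_le (part_vertex u) (part_vertex v) n)
  1 1 x1 x2) => //.
- by move=> *; apply: dist_le_sym.
- by move=> m n a b c; apply: dist_le_trans.
- by move=> m n a b; apply: dist_le_mono.
- by move=> a b _ _; apply: part_vertex_adj.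
move=> w wA; have [y Iy wy] := anchor w wA.
by have [h|h] := I12 _ Iy; [left|right]; rewrite -(part_vertex_eq h).
Qed.

Theorem layered_impression :
  impression H parts 770 9 /\
  forall A, A \in parts -> exists2 v, v \in A & v \in O.
Proof.
split; last by move=> _ /imsetP[v _ ->]; apply: part_outer.
split.
- split; last by move=> _ /imsetP[v _ ->]; apply: part_connected.
  apply/trivIsetP => _ _ /imsetP[u _ ->] /imsetP[v _ ->]; apply: contraNT.
  rewrite -setI_eq0 => /set0Pn[w /setIP[wu wv]].
  by rewrite -(part_eq wu) (part_eq wv).
- move=> _ /imsetP[v _ ->] A B; rewrite !inE => Av Bv.
  have [a [b [aE bE]]] := part_diameter (valP A) (valP B) Av Bv.
  (* The bound 38 is relaxed to 770. *)
  by rewrite (val_inj aE) (val_inj bE); apply: dist_le_mono.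
- move=> A AH P Q; rewrite !inE.
  case: P Q => P PM [Q QM] /= /set0Pn[u /setIP[uP uA]] /set0Pn[v /setIP[vQ vA]].
  have PE : P = part u by case/imsetP: (PM) uP => w _ -> /part_eq.
  have QE : Q = part v by case/imsetP: (QM) vQ => w _ -> /part_eq.
  have := member_parts AH uA vA.
  have -> : part_vertex u = Sub P PM by apply: val_inj.
  by have -> : part_vertex v = Sub Q QM by apply: val_inj.
- apply/setP => v; rewrite inE; apply/bigcupP; exists (part v); first exact: part_in.
  exact: part_id.
Qed.

End Layers.

(** * Discrete winding numbers and K_{3,3} *)

From mathcomp Require Import all_order all_algebra.
From mathcomp Require Import all_classical all_reals all_analysis.
From mathcomp Require Import lra.
Import Order.TTheory GRing.Theory Num.Theory.
Import numFieldNormedType.Exports.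

Fixpoint chain (T : Type) (r : T -> T -> Prop) (x : T) (s : seq T) : Prop :=
  if s is y :: s' then r x y /\ chain r y s' else True.

Section Winding.
Local Open Scope ring_scope.
Variable R : realType.
Local Notation P := (R * R)%type.
Implicit Types (p q x z : P) (e f : seq P) (K : set P).

(** Half-open quadrants numbered counterclockwise, each a quarter turn of the previous one; the
    origin receives the default value 3. *)
Definition quad z : int :=
  if (0 < z.1) && (0 <= z.2) then 0 else
  if (z.1 <= 0) && (0 < z.2) then 1 else
  if (z.1 < 0) && (z.2 <= 0) then 2 else 3.

(** The representative in -1, 0, 1, 2 of the difference modulo 4, a signed number of quarter turns.
    Between opposite quadrants the direction is ambiguous and 2 is a convention. *)
Definition turn z z' : int :=
  let k := quad z' - quad z in
  if k == 3 then -1 else if k == -3 then 1 else if k == -2 then 2 else k.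

Definition not_opposite z z' : Prop :=
  quad z' - quad z <> 2 /\ quad z' - quad z <> -2.

Lemma quad_range z : (0 <= quad z) /\ (quad z <= 3).
Proof. by rewrite /quad; do 3 case: ifP => _ //. Qed.

(** Pairwise non-opposite directions occupy at most two adjacent quadrants, so no full turn can
    arise. *)
Lemma turn_add z z' z'' : not_opposite z z' -> not_opposite z' z'' ->
  not_opposite z z'' -> turn z z' + turn z' z'' = turn z z''.
Proof.
have := quad_range z; have := quad_range z'; have := quad_range z''.
rewrite /not_opposite /turn; do ![case: eqP => ? //]; lia.
Qed.

Lemma turn_mod4 z z' : exists n : int, turn z z' = quad z' - quad z + 4 * n.
Proof.
rewrite /turn; case: eqP => [h|_]; first by exists (-1); lia.
case: eqP => [h|_]; first by exists 1; lia.
by case: eqP => [h|_]; [exists 1|exists 0]; lia.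
Qed.

Lemma quad_opp z : z != 0 ->
  exists2 t : int, (t = 0) \/ (t = 1) & quad (- z) - quad z = 2 - 4 * t.
Proof.
case: z => a b z0.
have {z0} : (a != 0) || (b != 0).
  apply: contraNT z0; rewrite negb_or !negbK => /andP[/eqP-> /eqP->] //.
rewrite /quad /= !oppr_gt0 !oppr_lt0 !oppr_ge0 !oppr_le0.
case: (ltgtP a 0) => ha; case: (ltgtP b 0) => hb //= _;
  solve [by exists 0; [left|lia] | by exists 1; [right|lia]].
Qed.

(** [turn] depends only on the difference of quadrants modulo 4, and negation shifts both quadrants
    by 2. *)
Lemma turn_opp z z' : z != 0 -> z' != 0 -> turn (- z) (- z') = turn z z'.
Proof.
move=> /quad_opp[t h1 h2] /quad_opp[t' h1' h2'].
have := quad_range z; have := quad_range z'.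
have := quad_range (-z); have := quad_range (-z').
rewrite /turn; move: h2 h2'.
move: (quad z) (quad z') (quad (- z)) (quad (- z')) => a b a' b'.
move=> h2 h2' [? ?] [? ?] [? ?] [? ?].
by case: h1 => ?; case: h1' => ?; subst t t'; do ![case: eqP => ? //]; lia.
Qed.

(** The norm is the maximum norm: between opposite quadrants both coordinates change sign, so each
    moves by at least its own absolute value. *)
Lemma close_not_opposite z z' : `|z - z'| < `|z| -> not_opposite z z'.
Proof.
case: z => a b; case: z' => a' b'.
rewrite !prod_normE /= !gt_max !lt_max !ltr_norml => /andP[/orP h1 /orP h2].
rewrite /not_opposite /quad /=.
case: (ltrgt0P a) h1 h2 => ha; case: (ltrgt0P b) => hb h1 h2;
case: (ltrgt0P a') => ha'; case: (ltrgt0P b') => hb' //=; exfalso;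
by case: h1 => /andP[? ?]; case: h2 => /andP[? ?]; lra.
Qed.

(** The discrete winding of the chain [q :: f] about [x], in quarter turns. *)
Fixpoint wind x q f : int :=
  if f is q' :: f' then turn (q - x) (q' - x) + wind x q' f' else 0.

Lemma wind_mod4 x q f :
  exists n : int, wind x q f = quad (last q f - x) - quad (q - x) + 4 * n.
Proof.
elim: f q => [|q' f IH] q /=; first by exists 0; lia.
have [n ->] := IH q'; have [m ->] := turn_mod4 (q - x) (q' - x).
by exists (n + m); lia.
Qed.

Definition short_step (d : R) K q q' := [/\ K q, K q' & `|q - q'| < d].

(** The scale [e] may change from step to step, so that a chain can come close to [K]; [d] is a
    common lower bound, to which the steps inside [K] are compared. *)
Definition clear_step (d : R) K p p' :=
  exists e : R, [/\ d <= e, `|p - p'| < e & forall q, K q -> 4 * e <= `|p - q|].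

(** The four differences have norm at least [3 * e] and pairwise distance below [2 * e], so no two
    of them are opposite and both sums equal the turn from [q - p] to [q' - p']. *)
Lemma turn_square (d : R) K p p' q q' :
  clear_step d K p p' -> short_step d K q q' ->
  turn (q - p) (q' - p) + turn (q' - p) (q' - p') =
  turn (q - p) (q - p') + turn (q - p') (q' - p').
Proof.
move=> [e [de pp' clr]] [Kq Kq' qq'].
have n1 := clr _ Kq; have n2 := clr _ Kq'.
have n3 : 3 * e <= `|p' - q|.
  by have := ler_distD p' p q; lra.
have n4 : 3 * e <= `|p' - q'|.
  by have := ler_distD p' p q'; lra.
have sw (u v w : P) : (u - w) - (v - w) = u - v by rewrite opprB addrA addrNK.
have sw' (u v w : P) : (w - u) - (w - v) = v - u.
  by rewrite opprB addrC addrA addrNK.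
have sw2 (u v u' v' : P) : `|(u - v) - (u' - v')| <= `|u - u'| + `|v - v'|.
  by rewrite opprD addrACA opprK [- v + _]addrC (distrC v); apply: ler_normD.
have n5 := sw2 q p q' p'; have e0 := le_lt_trans (normr_ge0 _) pp'.
rewrite !turn_add //; apply: close_not_opposite;
  rewrite ?sw ?sw' ?[`|q - p|]distrC ?[`|q' - p|]distrC ?[`|q - p'|]distrC
    ?[`|q' - p'|]distrC ?[`|p' - p|]distrC; lra.
Qed.

(** [turn_square] summed along [f]; the terms at interior points cancel. *)
Lemma wind_step (d : R) K p p' q f :
  clear_step d K p p' -> chain (short_step d K) q f ->
  wind p' q f - wind p q f =
  turn (last q f - p) (last q f - p') - turn (q - p) (q - p').
Proof.
move=> cl; elim: f q => [|q' f IH] q /=; first by lia.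
case=> st /IH {}IH; have := turn_square cl st; lia.
Qed.

(* The angle of [q - p] is well defined along the grid [e * f], so its total
   variation around the boundary of this grid vanishes. *)
Lemma wind_swap (d : R) K p e q f : K q ->
  chain (clear_step d K) p e -> chain (short_step d K) q f ->
  wind (last p e) q f - wind p q f = wind (last q f) p e - wind q p e.
Proof.
move=> Kq ce cf.
have Kl : K (last q f).
  by elim: f q Kq cf => //= q' f IH q _ [[_ Kq' _]]; apply: IH.
elim: e p ce => [|p' e IH] p /=; first by lia.
case=> cl /IH {}IH.
have := wind_step cl cf.
have [eps [de pp' clr]] := cl.
have e0 := le_lt_trans (normr_ge0 _) pp'.
have flip x : K x -> turn (p - x) (p' - x) = turn (x - p) (x - p').
  move=> Kx; rewrite -[p - x]opprB -[p' - x]opprB; apply: turn_opp.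
    rewrite subr_eq0; apply/eqP => E.
    by have := clr _ Kx; rewrite E subrr normr0; lra.
  rewrite subr_eq0; apply/eqP => E.
  by have := clr _ Kx; rewrite E; lra.
rewrite !flip //; lia.
Qed.

Lemma quad_antisym p q : p != q ->
  exists2 t : int, quad (q - p) - quad (p - q) = 2 - 4 * t &
                   quad (p - q) - quad (q - p) = 2 - 4 * (1 - t).
Proof.
move=> pq; have [|t _] := @quad_opp (p - q); first by rewrite subr_eq0.
rewrite opprB => h; exists t; first exact: h.
by rewrite -[LHS]opprB h; lia.
Qed.

(* Van Kampen's parity argument: the number of independent pairs of edges of
   K_{3,3} whose ends interleave is odd, whereas the winding numbers of the nine
   edges about the six vertices each enter an even number of the equations. *)
Lemma K33_parity (a b : 'I_3 -> P) (s : 'I_3 -> 'I_3 -> seq P) :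
  injective a -> injective b -> (forall i c, a i != b c) ->
  (forall i c, last (a i) (s i c) = b c) ->
  (forall i k c l, i != k -> c != l ->
     wind (b c) (a k) (s k l) - wind (a i) (a k) (s k l) =
     wind (b l) (a i) (s i c) - wind (a k) (a i) (s i c)) ->
  False.
Proof.
move=> ainj binj ab lst sw.
have /choice[n /= nE] : forall t : P * ('I_3 * 'I_3), exists n : int,
    wind t.1 (a t.2.1) (s t.2.1 t.2.2) =
    quad (b t.2.2 - t.1) - quad (a t.2.1 - t.1) + 4 * n.
  by case=> x [i c] /=; have := wind_mod4 x (a i) (s i c); rewrite lst.
have /choice[t tE] : forall pq : P * P, exists t : int, pq.1 != pq.2 ->
   (quad (pq.2 - pq.1) - quad (pq.1 - pq.2) = 2 - 4 * t) /\
   (quad (pq.1 - pq.2) - quad (pq.2 - pq.1) = 2 - 4 * (1 - t)).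
  case=> p q /=; have [->|/quad_antisym[t h1 h2]] := eqVneq p q; first by exists 0.
  by exists t.
pose N x i c := n (x, (i, c)).
(* The exchange identity [sw] divided by 4, after inserting [nE] and [tE]. *)
have eqn i k c l : i != k -> c != l ->
   N (b c) k l - N (a i) k l - N (b l) i c + N (a k) i c =
   1 - t (b l, b c) + t (a k, b c) - t (a i, b l) - t (a k, a i).
  move=> ik cl; have := sw _ _ _ _ ik cl.
  have := nE (b c, (k, l)); have := nE (a i, (k, l)).
  have := nE (b l, (i, c)); have := nE (a k, (i, c)); rewrite /= -!/(N _ _ _).
  move=> -> -> -> ->.
  have [] := tE (b l, b c); first by rewrite (inj_eq binj) eq_sym.
  have [] := tE (a k, b c); first exact: ab.
  have [] := tE (a i, b l); first exact: ab.
  have [] := tE (a k, a i); first by rewrite (inj_eq ainj) eq_sym.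
  rewrite /=; lia.
have tt c l : c != l -> t (b c, b l) + t (b l, b c) = 1.
  move=> cl.
  have [] := tE (b c, b l); first by rewrite (inj_eq binj).
  have [] := tE (b l, b c); first by rewrite (inj_eq binj) eq_sym.
  rewrite /=; lia.
pose j0 : 'I_3 := @Ordinal 3 0 isT; pose j1 : 'I_3 := @Ordinal 3 1 isT.
pose j2 : 'I_3 := @Ordinal 3 2 isT.
(* Adding the equations for both pairings of [c], [l] eliminates [t (b c, b l)] and [t (b l, b c)],
   whose sum is 1. *)
have pr i k c l : i != k -> c != l ->
    (N (b c) k l - N (a i) k l - N (b l) i c + N (a k) i c) +
    (N (b l) k c - N (a i) k c - N (b c) i l + N (a k) i l) =
    1 + t (a k, b c) + t (a k, b l) - t (a i, b l) - t (a i, b c)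
      - 2 * t (a k, a i).
  move=> ik cl; have := eqn _ _ _ _ ik cl.
  by rewrite eq_sym in cl; have := eqn _ _ _ _ ik cl; have := tt _ _ cl; lia.
(* The nine equations contribute nine ones, whereas modulo 2 each [N] term occurs twice and each
   [t (a i, b c)] four times. *)
have := pr j0 j1 j0 j1 isT isT; have := pr j0 j1 j0 j2 isT isT.
have := pr j0 j1 j1 j2 isT isT; have := pr j0 j2 j0 j1 isT isT.
have := pr j0 j2 j0 j2 isT isT; have := pr j0 j2 j1 j2 isT isT.
have := pr j1 j2 j0 j1 isT isT; have := pr j1 j2 j0 j2 isT isT.
have := pr j1 j2 j1 j2 isT isT.
lia.
Qed.

End Winding.

(** * Drawings in the plane *)

Lemma chain_cat (T : Type) (r : T -> T -> Prop) x s t :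
  chain r x s -> chain r (last x s) t -> chain r x (s ++ t).
Proof. by elim: s x => //= y s IH x [xy ys] h; split=> //; apply: IH. Qed.

Lemma chain_impl (T : Type) (r r' : T -> T -> Prop) x s :
  (forall y z, r y z -> r' y z) -> chain r x s -> chain r' x s.
Proof.
by move=> rr'; elim: s x => //= y s IH x [/rr' xy ys]; split=> //; apply: IH.
Qed.

Section Plane.
Local Open Scope classical_set_scope.
Local Open Scope ring_scope.
Variable R : realType.
Local Notation P := (R * R)%type.
Implicit Types (p q x z : P) (C K L : set P).

(** The points reached by chains from [p] form a nonempty relatively clopen set. One direction of
    [r] extends chains within a ball, the other shows that the unreached points form an open set. *)
Lemma connected_chain C (r : P -> P -> Prop) :
  connected C ->
  (forall p, C p -> exists2 e : R, 0 < e &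
     forall p', C p' -> `|p - p'| < e -> r p p' /\ r p' p) ->
  forall p q, C p -> C q -> exists2 s, chain r p s & last p s = q.
Proof.
move=> Cc loc p q Cp Cq.
have /choice[e eP] : forall x, exists e : R, C x ->
    0 < e /\ forall p', C p' -> `|x - p'| < e -> r x p' /\ r p' x.
  move=> x; have [/loc[e e0 h]|nC] := pselect (C x); first by exists e.
  by exists 0 => /nC.
pose Z := [set z | C z /\ exists2 s, chain r p s & last p s = z].
pose N (A : set P) := \bigcup_(z in A) (ball z (e z) : set P).
have Nopen (A : set P) : A `<=` C -> open (N A).
  move=> AC; apply: bigcup_open => z /AC /eP[ez _]; exact: ball_open.
have NI (A : set P) x : C x -> A x -> N A x.
  by move=> Cx Ax; exists x => //; apply: ballxx; case: (eP _ Cx).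
suff : Z = C by move=> ZC; have [] : Z q by rewrite ZC.
apply: Cc.
- by exists p; split=> //; exists [::].
- exists (N Z); first by apply: Nopen => z [].
  apply/seteqP; split=> [z Zz|z [Cz [y [Cy [s ps ly]]]]].
    by case: (Zz) => Cz _; split=> //; apply: NI.
  rewrite -ball_normE /= => yz; split=> //; exists (rcons s z).
    rewrite -cats1; apply: chain_cat => //=; rewrite ly; split=> //.
    by have [_ /(_ _ Cz yz)[]] := eP _ Cy.
  by rewrite last_rcons.
- exists (~` N (C `\` Z)).
    by apply: open_closedC; apply: Nopen => z [].
  apply/seteqP; split=> [z Zz|z [Cz nz]].
    case: (Zz) => Cz [s ps lz]; split=> // -[y [Cy nZy]].
    rewrite -ball_normE /= => yz; apply: nZy; split=> //.
    exists (rcons s y); last by rewrite last_rcons.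
    rewrite -cats1; apply: chain_cat => //=; rewrite lz; split=> //.
    by have [_ /(_ _ Cz yz)[]] := eP _ Cy.
  by apply: contrapT => nZz; apply: nz; apply: NI.
Qed.

(** The set of distances is compact, hence closed, and misses 0. *)
Lemma compact_dist K L : compact K -> compact L -> K `&` L = set0 ->
  exists2 e : R, 0 < e & forall p q, K p -> L q -> e <= `|p - q|.
Proof.
move=> cK cL KL.
have cI : compact [set `|t.1 - t.2| | t in K `*` L].
  apply: continuous_compact; last exact: compact_setX.
  apply: continuous_subspaceT => t.
  apply: cvg_norm; apply: cvgB; [exact: cvg_fst|exact: cvg_snd].
have /closed_openC := compact_closed (@Rhausdorff R) cI.
rewrite openE => /(_ 0) h.
have /h : (~` [set `|t.1 - t.2| | t in K `*` L]) 0.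
  move=> [[p q] /= [Kp Lq]] /eqP; rewrite normr_eq0 subr_eq0 => /eqP E.
  by have : (K `&` L) p; [split=> //; rewrite E|rewrite KL].
case/nbhs_ballP => e /= e0 he; exists e => // p q Kp Lq.
rewrite leNgt; apply/negP => lt.
apply: (he `|p - q|); last by exists (p, q).
by rewrite -ball_normE /= sub0r normrN normr_id.
Qed.

Lemma finite_min_pos (I : finType) (Q : I -> R -> Prop) :
  (forall i e e', 0 < e' -> e' <= e -> Q i e -> Q i e') ->
  (forall i, exists2 e, 0 < e & Q i e) ->
  exists2 e, 0 < e & forall i, Q i e.
Proof.
move=> mono ex.
suff [e e0 h] : exists2 e, 0 < e & forall i, i \in enum I -> Q i e.
  by exists e => // i; apply: h; rewrite mem_enum.
elim: (enum I) => [|i s [e e0 IH]]; first by exists 1.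
have [e' e'0 Qi] := ex i; exists (Num.min e e').
  by rewrite lt_min e0.
move=> j; rewrite inE => /orP[/eqP->|js].
  by apply: mono Qi; rewrite ?lt_min ?e0 // ge_min lexx orbT.
by apply: mono (IH _ js); rewrite ?lt_min ?e0 // ge_min lexx.
Qed.

End Plane.

(** * Drawings of induced subgraphs, and the outer face *)

Section Drawing.
Local Open Scope classical_set_scope.
Local Open Scope ring_scope.
Variables (R : realType) (G : sgraph) (E : plane_embedding R G).
Local Notation P := (R * R)%type.
Implicit Types (S T : {set G}) (p q : P).

Definition subdrawing S : set P :=
  [set p | (exists2 v, v \in S & p = pos E v) \/
           exists u v, [/\ u \in S, v \in S, adj u v & edge E u v p]].

Lemma subdrawing_setT : subdrawing [set: G]%SET = drawing E.
Proof.
apply/seteqP; split=> p.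
  by case=> [[v _ ->]|[u [v [_ _ uv ep]]]]; [left; exists v|right; exists u, v].
case=> [[v ->]|[u [v [uv ep]]]]; first by left; exists v.
by right; exists u, v; rewrite !inE.
Qed.

Lemma subdrawingS S T : S \subset T -> subdrawing S `<=` subdrawing T.
Proof.
move=> /fintype.subsetP ST p [[v /ST vS ->]|[u [v [/ST uS /ST vS uv ep]]]].
  by left; exists v.
by right; exists u, v.
Qed.

Lemma edge_compact u v : adj u v -> compact (edge E u v).
Proof.
move=> /(edge_arc E)[g [gc _ _ _ <-]]; apply: continuous_compact => //.
exact: segment_compact.
Qed.

Lemma edge_connected u v : adj u v -> connected (edge E u v).
Proof.
move=> /(edge_arc E)[g [gc _ _ _ <-]].
by apply: connected_continuous_connected => //; apply: segment_connected.
Qed.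

Lemma edge_ends u v : adj u v ->
  edge E u v (pos E u) /\ edge E u v (pos E v).
Proof.
move=> /(edge_arc E)[g [_ _ <- <- <-]].
by split; [exists 0|exists 1] => //=; rewrite in_itv /= lexx ler01.
Qed.

Lemma subdrawing_compact S : compact (subdrawing S).
Proof.
have -> : subdrawing S =
   (\big[setU/set0]_(v <- enum S) [set pos E v]) `|`
   (\big[setU/set0]_(uv <- [seq uv <- enum {: G * G} |
       [&& uv.1 \in S, uv.2 \in S & adj uv.1 uv.2]]) edge E uv.1 uv.2).
  rewrite -!bigcup_seq; apply/seteqP; split=> p.
    case=> [[v vS ->]|[u [v [uS vS uv ep]]]].
      by left; exists v => //=; rewrite mem_enum.
    by right; exists (u, v) => //=; rewrite mem_filter mem_enum /= uS vS uv.
  case=> [[v /= + ->]|[[u v] /=]]; first by rewrite mem_enum => vS; left; exists v.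
  by rewrite mem_filter => /andP[/and3P[uS vS uv] _] ep; right; exists u, v.
apply: compactU; first by apply: bigsetU_compact => v _; apply: compact_set1.
rewrite big_filter; apply: bigsetU_compact => -[u v] /and3P[_ _].
exact: edge_compact.
Qed.

Lemma subdrawing_pos S v : subdrawing S (pos E v) -> v \in S.
Proof.
case=> [[u uS /pos_inj->]|[u [w [uS wS uw /(edge_vertex uw)]]]] //.
by case=> ->.
Qed.

(** An edge inside [S] and an edge inside [T] have different pairs of ends, so [edge_edge] excludes
    common interior points, and [edge_vertex] excludes vertices on foreign edges. *)
Lemma subdrawing_disjoint S T : [disjoint S & T]%B ->
  subdrawing S `&` subdrawing T = set0.
Proof.
move=> dST; apply/seteqP; split=> // p [].
case=> [[v vS ->] /subdrawing_pos vT|]; first by have := disjointFr dST vS; rewrite vT.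
move=> [u [v [uS vS uv ep]]] pT.
have nTu : u \notin T by rewrite (disjointFr dST uS).
have nTv : v \notin T by rewrite (disjointFr dST vS).
have pu : p <> pos E u by move=> pE; rewrite pE in pT; rewrite (subdrawing_pos pT) in nTu.
have pv : p <> pos E v by move=> pE; rewrite pE in pT; rewrite (subdrawing_pos pT) in nTv.
case: pT => [[w wT pE]|[x [y [xT yT xy ep']]]].
  rewrite pE in ep; have [wE|wE] := edge_vertex uv ep; subst w.
    by rewrite wT in nTu.
  by rewrite wT in nTv.
have : ((edge E u v `\` [set pos E u; pos E v]) `&` edge E x y) p.
  by split=> //; split=> // -[].
rewrite edge_edge // => /setP /(_ u); rewrite !inE eqxx /= => /esym /orP[]/eqP uE.
  by rewrite uE xT in nTu.
by rewrite uE yT in nTu.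
Qed.

Lemma subdrawing_chain S (d : R) u v : 0 < d -> u \in S ->
  connect (induced_adj S) u v ->
  exists2 s, chain (short_step d (subdrawing S)) (pos E u) s &
             last (pos E u) s = pos E v.
Proof.
move=> d0 uS /connectP[w pw ->]; elim: w u uS pw => [|w s IH] u uS /=.
  by exists [::].
case/andP=> /and3P[_ wS uw] /(IH _ wS)[t ct lt].
have [|||t' ct' lt'] := @connected_chain R (edge E u w)
   (short_step d (subdrawing S)) (edge_connected uw) _ (pos E u) (pos E w).
- move=> p ep; exists d => // p' ep' pp'.
  have Dp : subdrawing S p by right; exists u, w.
  have Dp' : subdrawing S p' by right; exists u, w.
  by split; split=> //; rewrite distrC.
- by case: (edge_ends uw).
- by case: (edge_ends uw).
exists (t' ++ t); last by rewrite last_cat lt'.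
by apply: chain_cat => //; rewrite lt'.
Qed.

Lemma subdrawing_clear S p :
  ~ subdrawing S p -> exists2 e : R, 0 < e &
    forall q, subdrawing S q -> 4 * e <= `|p - q|.
Proof.
move=> nSp; have [|||e e0 he] := @compact_dist R [set p] (subdrawing S).
- exact: compact_set1.
- exact: subdrawing_compact.
- by apply/seteqP; split=> // q [/= ->].
by exists (e / 4) => [|q Sq]; [lra|have := he p q erefl Sq; lra].
Qed.

Lemma drawing_bounded : exists M : R, forall p, drawing E p -> `|p| <= M.
Proof.
have := compact_bounded (@subdrawing_compact [set: G]%SET).
rewrite subdrawing_setT => -[M [_ /(_ (M + 1))]].
by rewrite ltrDl ltr01 => h; exists (M + 1) => p; apply: h.
Qed.

Let far := connected_component (~` drawing E).

Lemma interval_far (g : R -> P) (s t : R) :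
  {within `[s, t], continuous g} -> s <= t ->
  (forall r, r \in `[s, t] -> ~ drawing E (g r)) -> far (g s) (g t).
Proof.
move=> gc st nD; exists (g @` `[s, t]); last first.
  by exists t => //=; rewrite in_itv /= lexx st.
split; first by exists s => //=; rewrite in_itv /= lexx st.
  by move=> _ [r rst <-]; apply: nD.
by apply: connected_continuous_connected => //; apply: segment_connected.
Qed.

Lemma curve_far (g : R -> P) (s t : R) : continuous g ->
  (forall r, ~ drawing E (g r)) -> far (g s) (g t).
Proof.
move=> gc nD; have [st|/ltW st] := leP s t.
  by apply: interval_far => //; apply: continuous_subspaceT.
by apply: connected_component_sym; apply: interval_far => //;
  apply: continuous_subspaceT.
Qed.

(** Outside a square containing the drawing, every point is joined to the corner [(N, N)] by a
    vertical and a horizontal segment avoiding the drawing. Hence all unbounded faces coincide. *)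
Lemma outer_face_unique : exists2 q0, ~ drawing E q0 &
  forall v, outer_vertex E v -> closure (far q0) (pos E v).
Proof.
have [M hM] := drawing_bounded.
have out p : M < `|p.1| \/ M < `|p.2| -> ~ drawing E p.
  move=> h /hM; rewrite prod_normE ge_max => /andP[].
  by case: h => /lt_geF ->.
pose N := `|M| + 1.
have NM : M < `|N|.
  by rewrite ger0_norm /N ?addr_ge0 // (le_lt_trans (ler_norm M)) // ltrDl.
exists (N, N); first by apply: out; left.
move=> v [F [[p nDp FE] nbF] cF].
have [p1 Fp1 p1M] : exists2 p1, F p1 & M < `|p1|.
  apply: contrapT => no; apply: nbF; exists M; split; first exact: num_real.
  move=> M' MM' q Fq; apply: (le_trans _ (ltW MM')); rewrite leNgt.
  by apply/negP => lt; apply: no; exists q.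
have hcont (b : R) : continuous (fun r : R => (r, b) : P).
  move=> r; apply: (@cvg_pair _ _ _ (nbhs r) (nbhs r) (nbhs b)).
    exact: cvg_id.
  exact: cvg_cst.
have vcont (b : R) : continuous (fun r : R => (b, r) : P).
  move=> r; apply: (@cvg_pair _ _ _ (nbhs r) (nbhs b) (nbhs r)).
    exact: cvg_cst.
  exact: cvg_id.
have fp1 : far p1 (N, N).
  case: p1 Fp1 p1M => a b _; rewrite prod_normE lt_max /= => /orP[ha|hb].
    apply: (@connected_component_trans _ _ (a, N)).
      by apply: (@curve_far (fun r => (a, r))) => // r; apply: out; left.
    by apply: (@curve_far (fun r => (r, N))) => // r; apply: out; right.
  apply: (@connected_component_trans _ _ (N, b)).
    by apply: (@curve_far (fun r => (r, b))) => // r; apply: out; right.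
  by apply: (@curve_far (fun r => (N, r))) => // r; apply: out; left.
suff -> : far (N, N) = F by [].
rewrite FE; apply: same_connected_component.
apply: connected_component_sym; apply: connected_component_trans fp1.
by rewrite FE in Fp1.
Qed.

Lemma far_chain q0 p K : far q0 p -> (forall q, K q -> drawing E q) ->
  exists2 d : R, 0 < d &
  exists2 s, chain (clear_step d K) p s & last p s = q0.
Proof.
move=> fp KD.
pose r (p p' : P) := exists e : R, [/\ 0 < e, `|p - p'| < e &
   forall q, K q -> 4 * e <= `|p - q|].
have nD : ~ drawing E q0.
  by case: (fp) => C [Cq0 CD _] _; apply: CD.
have [||||s cs ls] := @connected_chain R (far q0) r _ _ p q0.
- exact: component_connected.
- move=> x fx.
  have [|e e0 he] := @subdrawing_clear [set: G]%SET x.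
    by rewrite subdrawing_setT; apply: connected_component_sub fx.
  rewrite subdrawing_setT in he.
  (* Half the scale at [x] also works from a nearby [y], because [4 * e - e / 2] is at least
     [4 * (e / 2)]. *)
  exists (e / 2) => [|y fy xy]; first lra.
  split; exists (e / 2); split; rewrite ?[`|y - x|]distrC //; try lra.
    by move=> q /KD /he; lra.
  by move=> q /KD /he; have := ler_distD y x q; lra.
- by [].
- exact: connected_component_refl.
suff [d d0 hd] : exists2 d : R, 0 < d & chain (clear_step d K) p s.
  by exists d => //; exists s.
elim: s p cs {fp ls} => [|y s IH] p /=; first by exists 1.
case=> -[e [e0 py he]] /IH[d d0 cs].
exists (Num.min e d); first by rewrite lt_min e0.
split; first by exists e; split=> //; rewrite ge_min lexx.
apply: chain_impl cs => a b [e' [de' ab he']]; exists e'; split=> //.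
by rewrite ge_min de' orbT.
Qed.

Lemma clear_step_le (d d' : R) (K K' : set P) p q : d' <= d -> K' `<=` K ->
  clear_step d K p q -> clear_step d' K' p q.
Proof.
move=> dd K'K [e [de pq he]]; exists e; split=> //; first exact: le_trans de.
by move=> x /K'K; apply: he.
Qed.

Lemma short_clear S (d : R) p q :
  (forall x y, subdrawing S x -> subdrawing (~: S)%SET y -> 4 * d <= `|x - y|) ->
  short_step d (subdrawing S) p q -> clear_step d (subdrawing (~: S)%SET) p q.
Proof.
by move=> h [Sp Sq pq]; exists d; split=> // x Sx; apply: h.
Qed.

(* In the plane graph obtained by adding a vertex inside the outer face, the
   connected sets [W i c] carry the nine edges of a K_{3,3}.  Only edges without
   a common end have to be disjoint. *)
Theorem no_outer_K33 (a : 'I_3 -> G) (x y : G) (W : 'I_3 -> 'I_3 -> {set G}) :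
  (forall i c, connected_vset (W i c) /\ a i \in W i c) ->
  (forall i, x \in W i 0) -> (forall i, y \in W i 1) ->
  (forall i, exists2 o, o \in W i 2%:R & outer_vertex E o) ->
  (forall i k c l, i != k -> c != l -> [disjoint W i c & W k l]%B) ->
  False.
Proof.
move=> Wc xW yW oW dis.
have [q0 nDq0 q0P] := outer_face_unique.
(* The third value is the added vertex, placed at the point [q0] of the outer face. *)
pose b (c : 'I_3) : P := if c == 0 then pos E x else if c == 1 then pos E y else q0.
have subD S : subdrawing S `<=` drawing E.
  by rewrite -subdrawing_setT; apply: subdrawingS; apply: finset.subsetT.
(* There are finitely many vertex sets [S], so one clearance serves for all of them. *)
have [d1 d10 d1P] : exists2 d : R, 0 < d & forall S p q,
    subdrawing S p -> subdrawing (~: S)%SET q -> 4 * d <= `|p - q|.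
  apply: finite_min_pos => [S e e' _ ee' h p q Sp Sq|S].
    by apply: le_trans (h p q Sp Sq); rewrite ler_wpM2l.
  have [||| e e0 he] := @compact_dist R (subdrawing S) (subdrawing (~: S)%SET).
  - exact: subdrawing_compact.
  - exact: subdrawing_compact.
  - by apply: subdrawing_disjoint; rewrite -finset.setI_eq0 finset.setICr.
  by exists (e / 4) => [|p q Sp Sq]; [lra|have := he p q Sp Sq; lra].
have inner (d : R) i c v : 0 < d -> v \in W i c ->
    exists2 s, chain (short_step d (subdrawing (W i c))) (pos E (a i)) s &
      last (pos E (a i)) s = pos E v.
  move=> e0 vW; have [[_ cW] aW] := Wc i c.
  by apply: subdrawing_chain => //; apply: cW.
(* The edge to the added vertex: inside [W i 2%:R] to an outer vertex [w], then one step off the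
   drawing into the face, then through the face to [q0]. *)
have [d2 d20 d2P] : exists2 d : R, 0 < d & forall i,
    exists2 s, chain (clear_step d (subdrawing (~: W i 2%:R)%SET)) (pos E (a i)) s &
      last (pos E (a i)) s = q0.
  apply: finite_min_pos => [i e e' _ ee' [s cs ls]|i].
    by exists s => //; apply: chain_impl cs => p q; apply: clear_step_le.
  have [w oWi /q0P clo] := oW i.
  have [|e e0 he] := @subdrawing_clear (~: W i 2%:R)%SET (pos E w).
    by move=> /subdrawing_pos; rewrite inE oWi.
  have [p [fp]] := clo _ (nbhsx_ballx (pos E w) e e0).
  rewrite -ball_normE /= => op.
  have [|d d0 [s cs ls]] := @far_chain q0 p (subdrawing (~: W i 2%:R)%SET) fp.
    by move=> q /subD.
  have [t ct lt] := inner _ _ _ _ d10 oWi.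
  pose m := Num.min (Num.min d d1) e.
  have m0 : 0 < m by rewrite !lt_min d0 d10 e0.
  exists m => //; exists (t ++ p :: s); last by rewrite last_cat lt.
  apply: chain_cat.
    apply: chain_impl ct => u v /(short_clear (d1P _)); apply: clear_step_le => //.
    by rewrite !ge_min lexx ?orbT.
  rewrite lt /=; split; first by exists e; split=> //; rewrite ge_min lexx orbT.
  by apply: chain_impl cs => u v; apply: clear_step_le => //; rewrite !ge_min lexx.
pose d := Num.min d1 d2.
have d0 : 0 < d by rewrite lt_min d10 d20.
have dd1 : d <= d1 by rewrite ge_min lexx.
have dd2 : d <= d2 by rewrite ge_min lexx orbT.
have bW i c : c != 2%:R -> exists2 v, v \in W i c & b c = pos E v.
  case: c => [] [|[|[|//]]] lc //= _; [exists x|exists y] => //=.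
    by have -> : Ordinal lc = 0 by apply/val_inj.
  by have -> : Ordinal lc = 1 by apply/val_inj.
have /choice[s sP] : forall ic : 'I_3 * 'I_3, exists s,
   [/\ last (pos E (a ic.1)) s = b ic.2,
     chain (clear_step d (subdrawing (~: W ic.1 ic.2)%SET)) (pos E (a ic.1)) s &
     ic.2 != 2%:R -> chain (short_step d (subdrawing (W ic.1 ic.2))) (pos E (a ic.1)) s].
  case=> i c /=; have [->|c2] := eqVneq c 2%:R.
    have [s cs ls] := d2P i; exists s; split=> //.
    by apply: chain_impl cs => p q; apply: clear_step_le.
  have [v vW bE] := bW i c c2; have [s cs ls] := inner _ _ _ _ d0 vW.
  exists s; split=> //; first by rewrite bE.
  apply: chain_impl cs => p q; apply: short_clear => u w Su Sw.
  by apply: le_trans (d1P _ _ _ Su Sw); rewrite ler_wpM2l.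
have other (i : 'I_3) : exists2 k, k != i & true.
  by case: i => [] [|[|[|//]]] li; [exists 1|exists 0|exists 0].
have aNb i c : pos E (a i) != b c.
  have [->|c2] := eqVneq c 2%:R.
    apply/eqP => h; apply: nDq0; rewrite -[q0]/(b 2%:R) -h.
    by left; exists (a i).
  have [k ki _] := other i; have [v vW ->] := bW k c c2.
  apply/eqP => /pos_inj av; have [_ aW] := Wc i 2%:R.
  rewrite eq_sym in ki; rewrite eq_sym in c2.
  by have := disjointFr (dis _ _ _ _ ki c2) aW; rewrite av vW.
have ainj : injective (fun i => pos E (a i)).
  move=> i k /pos_inj ak; apply/eqP; apply: contraT => ik.
  have [_ aW] := Wc i 0; have [_ aW'] := Wc k 1.
  by have := disjointFr (dis _ _ 0 1 ik isT) aW; rewrite ak aW'.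
have binj : injective b.
  have b2 c : c != 2%:R -> b c <> q0.
    move=> c2; have [v _ ->] := bW 0 c c2 => h; apply: nDq0; rewrite -h.
    by left; exists v.
  move=> c l bb; apply/eqP; apply: contraT => cl.
  have [cE|c2] := eqVneq c 2%:R.
    by case: (b2 l); [rewrite -cE eq_sym|rewrite -bb cE].
  have [lE|l2] := eqVneq l 2%:R; first by case: (b2 c); rewrite // bb lE.
  have [v vW bE] := bW 0 c c2; have [w wW bE'] := bW 1 l l2.
  move: bb; rewrite bE bE' => /pos_inj vw.
  by have := disjointFr (dis 0 1 _ _ isT cl) vW; rewrite vw wW.
apply: (@K33_parity R (fun i => pos E (a i)) b (fun i c => s (i, c))) => //.
  by move=> i c; case: (sP (i, c)).
(* [wind_swap] needs short steps on its second chain, which are available only for edges not ending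
   at [q0]. At most one of [c] and [l] is the index of [q0], and the identity is symmetric in the
   two edges. *)
suff key i k c l : i != k -> c != l -> l != 2%:R ->
     wind (b c) (pos E (a k)) (s (k, l)) - wind (pos E (a i)) (pos E (a k)) (s (k, l)) =
     wind (b l) (pos E (a i)) (s (i, c)) - wind (pos E (a k)) (pos E (a i)) (s (i, c)).
  move=> i k c l ik cl; have [l2|l2] := eqVneq l 2%:R; last exact: key.
  by apply/esym; apply: key; rewrite 1?eq_sym // -l2 eq_sym.
move=> ik cl l2.
have [/= le ce _] := sP (i, c); have [/= lf _ /(_ l2) cf] := sP (k, l).
rewrite -le -lf; apply: wind_swap _ _ cf.
  by left; exists (a k) => //; case: (Wc k l).
apply: chain_impl ce => u v; apply: clear_step_le => //; apply: subdrawingS.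
by rewrite finset.subsets_disjoint finset.setCK disjoint_sym; apply: dis.
Qed.

End Drawing.

Lemma outer_no_K33 (R : realType) (G : sgraph) (E : plane_embedding R G) :
  no_K33 [set v | `[< outer_vertex E v >]].
Proof.
move=> a x y X Y Z cXYZ aXYZ xyZ dis.
pose W (i c : 'I_3) := if c == 0%R then X i else if c == 1%R then Y i else Z i.
apply: (@no_outer_K33 R G E a x y W).
- move=> i c; have [cX cY cZ] := cXYZ i; have [aX aY aZ] := aXYZ i.
  by rewrite /W; do 2?case: ifP.
- by move=> i; case: (xyZ i).
- by move=> i; case: (xyZ i).
- move=> i; have [_ _ [v vZ]] := xyZ i; rewrite inE => /asboolP vo.
  by exists v.
move=> i k c l ik; have [d1 d2 d3] := dis _ _ ik; rewrite eq_sym in ik.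
have [d4 d5 d6] := dis _ _ ik.
rewrite /W; case: c => [] [|[|[|//]]] lc; case: l => [] [|[|[|//]]] ll //= _;
  by rewrite // disjoint_sym.
Qed.

(** * Vertices outside every member *)

Section Uncovered.
Variables (G : sgraph) (H : {set {set G}}).

(** [layered_impression] asks for a family covering all vertices. When [H] spans [G], the vertices
    added here are isolated. *)
Definition with_singletons : {set {set G}} :=
  H :|: [set [set v] | v in [set v | ~~ [exists A in H, v \in A]]].

Lemma with_singletonsP A : A \in with_singletons ->
  A \in H \/ exists2 v, A = [set v]%SET & forall B, B \in H -> v \notin B.
Proof.
case/setUP=> [|/imsetP[v]]; first by left.
by rewrite inE => /exists_inPn nv ->; right; exists v.
Qed.

(** An added singleton meets no member of [H], so a walk that starts in [H] never leaves [H]. *)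
Lemma rig_near_with_singletons n A B : A \in H -> B \in H ->
  rig_near with_singletons n A B -> rig_near H n A B.
Proof.
move=> AH BH [a [b [aE <- [p [ap <- pn]]]]]; apply: rig_near_mono pn _.
elim: p a A AH aE ap => [|c p IH] a A AH aE /=.
  by rewrite aE => _; apply: rig_near_refl.
case/andP=> /andP[_ /set0Pn[v /setIP[va vc]]] cp.
have cH : val c \in H.
  case: (with_singletonsP (valP c)) => // -[w cE nw].
  move: vc va; rewrite cE inE => /eqP ->; rewrite aE => wA.
  by have := nw _ AH; rewrite wA.
rewrite -add1n; apply: rig_near_trans (IH c _ cH erefl cp).
by apply: rig_near_meet vc => //; rewrite -aE.
Qed.

End Uncovered.

(** An isolated vertex forms a set of [M] by itself, so it must be incident to the outer face; this
    is what [isolated_outer] provides. The layers are built for [with_singletons H], and the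
    distances are then carried back to [H]. *)
Theorem theorem3p1 (R : realType) (G : sgraph) (E : plane_embedding R G)
    (H : {set {set G}})
    (H_connected : forall A : {set G}, A \in H -> connected_vset A)
    (H_spans : spans H)
    (H_outer : forall A : {set G}, A \in H ->
       exists2 v : G, v \in A & outer_vertex E v)
    (isolated_outer : forall v : G,
       (forall u : G, ~~ adj v u) -> outer_vertex E v) :
  exists2 M : {set {set G}},
    impression H M 770 9 &
    forall A : {set G}, A \in M -> exists2 v : G, v \in A & outer_vertex E v.
Proof.
pose O : {set G} := [set v | `[< outer_vertex E v >]].
have memO v : v \in O -> outer_vertex E v by rewrite inE => /asboolP.
have Omem v : outer_vertex E v -> v \in O by move=> h; rewrite inE; apply/asboolP.
have subH A : A \in H -> A \in with_singletons H by move=> AH; apply/setUP; left.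
have conn' A : A \in with_singletons H -> connected_vset A.
  case/with_singletonsP => [/H_connected //|[v -> _]].
  split; first by apply/set0Pn; exists v; rewrite inE.
  by move=> x y; rewrite !inE => /eqP -> /eqP ->.
have spans' : spans (with_singletons H).
  by move=> u v /H_spans[A /subH AH uvA]; exists A.
have outer' A : A \in with_singletons H -> exists2 v, v \in A & v \in O.
  case/with_singletonsP => [/H_outer[v vA /Omem vO]|[v -> nv]]; first by exists v.
  exists v; first by rewrite inE.
  apply/Omem/isolated_outer => u; apply/negP => /H_spans[B BH /andP[vB _]].
  by have := nv _ BH; rewrite vB.
have cover' v : exists2 A, A \in with_singletons H & v \in A.
  have [/exists_inP[A AH vA]|nv] := boolP [exists A in H, v \in A].
    by exists A => //; apply: subH.
  exists [set v]%SET; last by rewrite inE.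
  by apply/setUP; right; apply/imsetP; exists v; rewrite ?inE.
have [[triv diam meet cov] out] :=
  layered_impression conn' spans' outer' cover' (@outer_no_K33 R G E).
exists (parts O cover'); last first.
  by move=> A /out[v vA /memO vO]; exists v.
split=> //; last by move=> A /subH; apply: meet.
move=> P PM A B; rewrite !inE => AP BP.
have AH := subH _ (valP A); have BH := subH _ (valP B).
have nAB : rig_near (with_singletons H) 770 (val A) (val B).
  exists (Sub (val A) AH), (Sub (val B) BH); split=> //.
  by apply: (diam _ PM); rewrite inE.
have [a [b [aE bE]]] := rig_near_with_singletons (valP A) (valP B) nAB.
by rewrite (val_inj aE) (val_inj bE).
Qed.
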